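(* Let $f=f_1\cdots f_n:(\mathbb{C}^2,0)\to(\mathbb{C},0)$ be a germ of a holomorphic function without repeated irreducible factors, where each $f_i$ is a germ $(\mathbb{C}^2,0)\to(\mathbb{C},0)$. Then $$I_f=\sum_{i=1}^n I_{f_i}+6\sum_{i<j}m(f_i,f_j),\qquad V_f=\sum_{i=1}^n V_{f_i}+12\sum_{i<j}m(f_i,f_j).$$
   Context: $\mathcal{O}_2$ is the ring of germs at $0$ of holomorphic functions on $\mathbb{C}^2$. For $f,g\in\mathcal{O}_2$, $m(f,g)=\dim_{\mathbb{C}}\mathcal{O}_2/\langle f,g\rangle\in\mathbb{N}\cup\{0,\infty\}$ is the intersection number. For $f\in\mathcal{O}_2$ put $$i_f=f_y^2f_{xx}-2f_xf_yf_{xy}+f_x^2f_{yy},$$ $$v_f=(f_x^2+f_y^2)\left(f_x^3f_{yyy}-3f_x^2f_yf_{xyy}+3f_xf_y^2f_{xxy}-f_y^3f_{xxx}\right)-3\left((f_x^2-f_y^2)f_{xy}-f_xf_y(f_{xx}-f_{yy})\right)i_f,$$ and $I_f=m(f,i_f)$, $V_f=m(f,v_f)$ (possibly $\infty$, with the usual conventions for sums). *)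

(* Defs.v *)
From HB Require Import structures.
From mathcomp Require Import all_boot all_order all_algebra.
From mathcomp Require Import complex.
From mathcomp Require Import all_classical all_reals all_analysis.
Set Implicit Arguments.
Unset Strict Implicit.
Unset Printing Implicit Defensive.
Import Order.TTheory GRing.Theory Num.Theory.
Import numFieldNormedType.Exports.
Local Open Scope classical_set_scope.
Local Open Scope ring_scope.
Local Open Scope complex_scope.

HB.instance Definition _ (R : realType) := NormedModule.copy R[i] R[i]^o.

(* Convergence, derivatives and neighbourhoods in C^2 are the library's ones for
   the field C = R[i], so the partial derivatives below are complex ones. *)
Notation C2 R := (R[i] * R[i])%type.

Definition power_series_term (R : realType) (a : nat -> nat -> R[i])
  (z : C2 R) (i j : nat) : R[i] := a i j * z.1 ^+ i * z.2 ^+ j.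

(* The absolute convergence makes the limit independent of the order of
   summation; square partial sums are as good as any other. *)
Definition power_series_to (R : realType) (a : nat -> nat -> R[i])
  (z : C2 R) (l : R[i]) : Prop :=
  (exists M : R[i], forall n : nat,
     \sum_(i < n) \sum_(j < n) `|power_series_term a z i j| <= M) /\
  (fun n : nat => \sum_(i < n) \sum_(j < n) power_series_term a z i j) @ \oo
     --> l.

Definition has_power_series_at (R : realType) (f : C2 R -> R[i]) (p : C2 R) :
  Prop :=
  exists a : nat -> nat -> R[i],
    \forall z \near (0 : C2 R), power_series_to a z (f (p + z)).

(* Elements of O_2 are represented by total functions C^2 -> C that are
   holomorphic on a neighbourhood of 0, i.e. are locally the sum of a convergent
   power series at every point of that neighbourhood; values elsewhere are
   irrelevant, since two functions are the same germ when they agree near 0. *)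
Definition holomorphic_germ (R : realType) (f : C2 R -> R[i]) : Prop :=
  \forall p \near (0 : C2 R), has_power_series_at f p.

Definition germ_eq (R : realType) (f g : C2 R -> R[i]) : Prop :=
  \forall z \near (0 : C2 R), f z = g z.

Definition germ_dvd (R : realType) (f g : C2 R -> R[i]) : Prop :=
  exists2 h : C2 R -> R[i], holomorphic_germ h & germ_eq g (f * h).

Definition germ_unit (R : realType) (f : C2 R -> R[i]) : Prop :=
  germ_dvd f 1.

Definition germ_irreducible (R : realType) (p : C2 R -> R[i]) : Prop :=
  [/\ holomorphic_germ p, ~ germ_eq p 0, ~ germ_unit p &
    forall a b : C2 R -> R[i], holomorphic_germ a -> holomorphic_germ b ->
      germ_eq p (a * b) -> germ_unit a \/ germ_unit b].

Definition germ_reduced (R : realType) (f : C2 R -> R[i]) : Prop :=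
  forall p : C2 R -> R[i], germ_irreducible p -> ~ germ_dvd (p ^+ 2) f.

Definition germ_ideal2 (R : realType) (f g : C2 R -> R[i]) :
  set (C2 R -> R[i]) :=
  [set h | exists a b : C2 R -> R[i],
    [/\ holomorphic_germ a, holomorphic_germ b & germ_eq h (a * f + b * g)]].

(* The classes of v_0, ..., v_(n-1) in O_2 / <f, g> are C-linearly independent. *)
Definition free_mod_ideal2 (R : realType) (f g : C2 R -> R[i]) (n : nat)
  (v : 'I_n -> (C2 R -> R[i])) : Prop :=
  forall c : 'I_n -> R[i],
    germ_ideal2 f g (fun z => \sum_(i < n) c i * v i z) -> forall i, c i = 0.

(* dim_C O_2 / <f, g>, as the supremum of the sizes of its linearly independent
   families; +oo when the quotient is infinite dimensional. *)
Definition intersection_number (R : realType) (f g : C2 R -> R[i]) : \bar R :=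
  ereal_sup [set n%:R%:E | n in [set n : nat |
    exists v : 'I_n -> (C2 R -> R[i]),
      (forall i, holomorphic_germ (v i)) /\ free_mod_ideal2 f g v]].

Definition dx (R : realType) (f : C2 R -> R[i]) : C2 R -> R[i] :=
  'D_((1, 0) : C2 R) f.
Definition dy (R : realType) (f : C2 R -> R[i]) : C2 R -> R[i] :=
  'D_((0, 1) : C2 R) f.

Definition inflection_germ (R : realType) (f : C2 R -> R[i]) : C2 R -> R[i] :=
  let fx := dx f in let fy := dy f in
  let fxx := dx fx in let fxy := dy fx in let fyy := dy fy in
  fy ^+ 2 * fxx - 2 * fx * fy * fxy + fx ^+ 2 * fyy.

Definition vertex_germ (R : realType) (f : C2 R -> R[i]) : C2 R -> R[i] :=
  let fx := dx f in let fy := dy f in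
  let fxx := dx fx in let fxy := dy fx in let fyy := dy fy in
  let fxxx := dx fxx in let fxxy := dy fxx in
  let fxyy := dy fxy in let fyyy := dy fyy in
  (fx ^+ 2 + fy ^+ 2) *
    (fx ^+ 3 * fyyy - 3 * fx ^+ 2 * fy * fxyy + 3 * fx * fy ^+ 2 * fxxy
      - fy ^+ 3 * fxxx)
  - 3 * ((fx ^+ 2 - fy ^+ 2) * fxy - fx * fy * (fxx - fyy)) *
    inflection_germ f.

Definition inflection_number (R : realType) (f : C2 R -> R[i]) : \bar R :=
  intersection_number f (inflection_germ f).

Definition vertex_number (R : realType) (f : C2 R -> R[i]) : \bar R :=
  intersection_number f (vertex_germ f).

(* Main.v *)
(* Modulo [f_i], the Leibniz rule gives [i_f = g^3 i_(f_i)] and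
   [v_f = g^6 v_(f_i)] for [f = f_i g], so everything follows from the additivity
   [m(f, g h) = m(f, g) + m(f, h)] applied to both arguments.

   Additivity is clear when a summand is infinite, since [m] is antitone in the
   ideal. When both are finite, concatenating bases works as soon as [h] is not a
   zero divisor modulo [f]. No unique factorization is needed for this: finiteness
   puts powers [X^k], [Y^m] of the coordinates in [<f, h>], so [h u = f v] makes
   [X^k u] and [Y^m u] multiples of [f], and comparing the two quotients in the
   domain [O_2], where [X^k] and [Y^m] are coprime, shows that [f] divides [u]. *)
Require Import Defs.
From HB Require Import structures.
From mathcomp Require Import all_boot all_order all_algebra.
From mathcomp Require Import complex.
From mathcomp Require Import all_classical all_reals all_analysis.
From mathcomp Require Import ring lra.
Import Order.TTheory GRing.Theory Num.Theory.
Import numFieldNormedType.Exports.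
Local Open Scope classical_set_scope.
Local Open Scope ring_scope.
Local Open Scope complex_scope.
Set Implicit Arguments.
Unset Strict Implicit.
Unset Printing Implicit Defensive.

(** * Sequences of complex numbers *)

(** Since a germ must have a power series at every point near 0, sums, products, derivatives and
    quotients are built from coefficient estimates at an arbitrary base point. Absolute convergence
    is traded for a geometric bound on the coefficients, so that terms decay like powers of 1/2 on a
    small polydisc. Facts about $y$ come from those about $x$ by exchanging the coordinates.

    A power of $X$ lies in an ideal of finite codimension because enough powers of $X$ are linearly
    dependent modulo it: the relation is a polynomial in $X$, it splits over the algebraically
    closed field, and its factors with nonzero root are units.

    The Leibniz congruences have a geometric source: $i_f$ is the Hessian of $f$ on the tangent
    vector $(f_y,-f_x)$, which $df$ kills. The factors 6 and 12 are twice the exponents 3 and 6,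
    each pair $i<j$ being met once from $f_i$ and once from $f_j$. *)

Section ComplexSequences.
Variable R : realType.
Implicit Types (u : nat -> R[i]) (M l z : R[i]).

Lemma ler_norm_Re z : `|complex.Re z|%:C <= `|z|.
Proof.
rewrite normc_def lecR -sqrtr_sqr ler_sqrt; last by rewrite addr_ge0 ?sqr_ge0.
by rewrite lerDl sqr_ge0.
Qed.

Lemma ler_norm_Im z : `|complex.Im z|%:C <= `|z|.
Proof.
rewrite normc_def lecR -sqrtr_sqr ler_sqrt; last by rewrite addr_ge0 ?sqr_ge0.
by rewrite lerDr sqr_ge0.
Qed.

(** In the order of [R[i]] a positive element has zero imaginary part, so the epsilon of a complex
    limit is a real epsilon. *)
Lemma gtr0_Re_real (e : R[i]) : 0 < e -> e = (complex.Re e)%:C /\ 0 < complex.Re e.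
Proof. by case: e => a b; rewrite ltcE /= => /andP[/eqP -> ?]. Qed.

Lemma cvgn_real_complex (u : nat -> R) (l : R) :
  u @ \oo --> l -> (fun n => (u n)%:C : R[i]) @ \oo --> (l%:C : R[i]).
Proof.
move=> /cvgrPdist_le ul; apply/cvgrPdist_le => e /gtr0_Re_real[-> e0].
move: (ul _ e0); apply: filterS => n.
by rewrite -rmorphB normc_def /= expr0n addr0 sqrtr_sqr lecR.
Qed.

Lemma cvgn_half_expr : (fun n => 2^-1 ^+ n : R[i]) @ \oo --> (0 : R[i]).
Proof.
have h : (2^-1 : R[i]) = (2^-1 : R)%:C by rewrite fmorphV rmorph_nat.
have -> : (fun n => 2^-1 ^+ n : R[i]) = (fun n => ((2^-1 : R) ^+ n)%:C).
  by apply/funext => n; rewrite h rmorphXn.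
apply: (@cvgn_real_complex _ 0); apply: cvg_expr.
by rewrite ger0_norm; lra.
Qed.

Lemma cvgn_geometric_bound u M :
  (forall n, `|u n| <= M * 2^-1 ^+ n) -> u @ \oo --> (0 : R[i]).
Proof.
move=> uM; apply/cvgr0Pnorm_le => e e0.
have : (fun n => M * 2^-1 ^+ n) @ \oo --> (M * 0 : R[i]).
  by apply: cvgM; [exact: cvg_cst|exact: cvgn_half_expr].
rewrite mulr0 => /cvgr0Pnorm_le /(_ _ e0); apply: filterS => n.
(* [M] is arbitrary, but [M * 2^-1 ^+ n] bounds a norm, hence is nonnegative and comparable with its
   own norm. *)
by apply: le_trans; rewrite (le_trans (uM n))// real_ler_norm// ger0_real//
  (le_trans _ (uM n)).
Qed.

Lemma real_cvgn_geometric_step (u : nat -> R) (M : R) :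
  (forall n, `|u n.+1 - u n| <= M * 2^-1 ^+ n) -> cvgn u.
Proof.
move=> uM.
have -> : u = (fun n => u 0%N + series (fun n => u n.+1 - u n) n).
  by apply/funext => n; rewrite seriesEnat/= telescope_sumr//; ring.
apply: is_cvgD; first exact: is_cvg_cst.
apply: normed_cvg; apply: (@series_le_cvg _ _ (geometric M 2^-1)).
- by move=> n; exact: normr_ge0.
- by move=> n; rewrite /= (le_trans _ (uM n)).
- by move=> n; exact: uM.
- by apply: is_cvg_geometric_series; rewrite ger0_norm; lra.
Qed.

(** Real and imaginary parts have increments no larger than those of [u], so completeness of [R]
    applies to each. *)
Lemma cvgn_geometric_step u M :
  (forall n, `|u n.+1 - u n| <= M * 2^-1 ^+ n) ->
  exists l, u @ \oo --> l.
Proof.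
move=> uM.
have M0 : 0 <= M by have := uM 0%N; rewrite expr0 mulr1; apply: le_trans.
have h n : (2^-1 ^+ n : R[i]) = ((2^-1 : R) ^+ n)%:C.
  by rewrite rmorphXn fmorphV rmorph_nat.
have ME : M = (complex.Re M)%:C by case: (M) M0 => a b; rewrite lecE /= => /andP[/eqP ->].
have cRe : cvgn (fun n => complex.Re (u n)).
  apply: (@real_cvgn_geometric_step _ (complex.Re M)) => n.
  rewrite -lecR rmorphM /= -h -ME (le_trans _ (uM n))//.
  by apply: le_trans (ler_norm_Re _); rewrite lecR raddfB.
have cIm : cvgn (fun n => complex.Im (u n)).
  apply: (@real_cvgn_geometric_step _ (complex.Re M)) => n.
  rewrite -lecR rmorphM /= -h -ME (le_trans _ (uM n))//.
  by apply: le_trans (ler_norm_Im _); rewrite lecR raddfB.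
move: cRe cIm => /cvg_ex[a /cvgn_real_complex ca] /cvg_ex[b /cvgn_real_complex cb].
exists (a%:C + 'i%C * b%:C).
have -> : u = (fun n => (complex.Re (u n))%:C + 'i%C * (complex.Im (u n))%:C).
  by apply/funext => n; exact: complexE.
have ci : (fun n : nat => 'i%C : R[i]) @ \oo --> ('i%C : R[i]) by exact: cvg_cst.
exact: (cvgD ca (cvgM ci cb)).
Qed.

End ComplexSequences.

(** * Double sums *)

Section DoubleSums.
Variable R : realType.
Implicit Types (a b : nat -> nat -> R[i]) (M : R[i]).

Definition square_sum a (n : nat) : R[i] := \sum_(i < n) \sum_(j < n) a i j.

(** The ratio 1/2 keeps constants explicit: each summation over one index costs a factor 2. *)
Definition half_bounded M a :=
  forall i j : nat, `|a i j| <= M * 2^-1 ^+ (i + j).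

Definition Cauchy_product a b (i j : nat) : R[i] :=
  \sum_(k < i.+1) \sum_(l < j.+1) a k l * b (i - k)%N (j - l)%N.

Lemma half_expr_ge0 n : 0 <= (2^-1 ^+ n : R[i]).
Proof. by rewrite exprn_ge0// invr_ge0. Qed.

Lemma half_expr_le m n : (m <= n)%N -> 2^-1 ^+ n <= (2^-1 ^+ m : R[i]).
Proof.
by move=> mn; rewrite ler_wiXn2l// ?invr_ge0// invf_le1// ler1n.
Qed.

Lemma sum_half_expr_le n : \sum_(i < n) 2^-1 ^+ i <= (2 : R[i]).
Proof.
suff -> : \sum_(i < n) 2^-1 ^+ i = 2 - 2 * 2^-1 ^+ n :> R[i].
  by rewrite gerDl oppr_le0 mulr_ge0// half_expr_ge0.
elim: n => [|n IH]; first by rewrite big_ord0 expr0; ring.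
by rewrite big_ord_recr/= IH exprS; field.
Qed.

Lemma half_bounded_ge0 M a : half_bounded M a -> 0 <= M.
Proof. by move/(_ 0 0)%N; rewrite expr0 mulr1; apply: le_trans. Qed.

Lemma half_bounded_tr M a : half_bounded M a -> half_bounded M (fun i j => a j i).
Proof. by move=> aM i j; rewrite addnC. Qed.

Lemma half_bounded_row M a n m : half_bounded M a ->
  \sum_(j < m) `|a n j| <= M * 2 * 2^-1 ^+ n.
Proof.
move=> aM; have M0 := half_bounded_ge0 aM.
apply: (@le_trans _ _ (\sum_(j < m) M * 2^-1 ^+ n * 2^-1 ^+ j)).
  by apply: ler_sum => j _; rewrite -mulrA -exprD.
rewrite -mulr_sumr [leRHS]mulrAC ler_wpM2l ?sum_half_expr_le//.
by rewrite mulr_ge0 ?half_expr_ge0.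
Qed.

Lemma half_bounded_abs_sum M a n : half_bounded M a ->
  \sum_(i < n) \sum_(j < n) `|a i j| <= M * 2 * 2.
Proof.
move=> aM; have M0 := half_bounded_ge0 aM.
apply: (@le_trans _ _ (\sum_(i < n) M * 2 * 2^-1 ^+ i)).
  by apply: ler_sum => i _; exact: half_bounded_row.
by rewrite -mulr_sumr ler_wpM2l ?sum_half_expr_le// mulr_ge0.
Qed.

Lemma square_sum_cvg M a : half_bounded M a ->
  exists l : R[i], square_sum a @ \oo --> l.
Proof.
move=> aM; have M0 := half_bounded_ge0 aM.
(* Going from size n to n+1 adds one row and one column, each bounded by [M * 2 * 2^-1 ^+ n]. *)
apply: (@cvgn_geometric_step _ _ (M * 2 + M * 2)) => n.
have -> : square_sum a n.+1 - square_sum a n =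
    \sum_(j < n.+1) a n j + \sum_(i < n) a i n.
  rewrite /square_sum big_ord_recr/=.
  under eq_bigr => i _ do rewrite big_ord_recr/=.
  by rewrite big_split/=; ring.
rewrite mulrDl (le_trans (ler_normD _ _))// lerD//.
  by rewrite (le_trans (ler_norm_sum _ _ _))// half_bounded_row.
rewrite (le_trans (ler_norm_sum _ _ _))//.
exact: (half_bounded_row _ _ (half_bounded_tr aM)).
Qed.

(** Differentiating or dividing by a coordinate shifts one index, which turns square partial sums
    into rectangles with one extra row; that row tends to 0. *)
Lemma rectangle_sum_cvg M a (l : R[i]) : half_bounded M a -> square_sum a @ \oo --> l ->
  (fun n => \sum_(i < n.+1) \sum_(j < n) a i j) @ \oo --> l.
Proof.
move=> aM al.
have row0 : (fun n => \sum_(j < n) a n j) @ \oo --> (0 : R[i]).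
  apply: (@cvgn_geometric_bound _ _ (M * 2)) => n.
  by rewrite (le_trans (ler_norm_sum _ _ _))// half_bounded_row.
have -> : (fun n => \sum_(i < n.+1) \sum_(j < n) a i j) =
    square_sum a + (fun n => \sum_(j < n) a n j).
  by apply/funext => n; rewrite big_ord_recr.
by rewrite -[l]addr0; exact: (cvgD al row0).
Qed.

Lemma sum_antidiagonal (V : zmodType) (F : nat -> nat -> V) n :
  \sum_(i < n) \sum_(k < i.+1) F k (i - k)%N =
  \sum_(k < n) \sum_(l < n | (k + l < n)%N) F k l.
Proof.
transitivity (\sum_(k < n) \sum_(l < n - k) F k l).
  elim: n => [|n IH]; first by rewrite !big_ord0.
  rewrite big_ord_recr/= IH.
  have -> : \sum_(k < n.+1) \sum_(l < n.+1 - k) F k l =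
      \sum_(k < n.+1) (\sum_(l < n - k) F k l + F k (n - k)%N).
    by apply: eq_bigr => k _; rewrite subSn -1?ltnS// big_ord_recr.
  rewrite big_split/= [in RHS]big_ord_recr/=.
  by rewrite [X in _ = _ + X + _]big1 ?addr0// => -[l]; rewrite subnn.
apply: eq_bigr => k _.
rewrite (big_ord_widen n (F k)) ?leq_subr//.
by apply: eq_bigl => l; rewrite ltn_subRL.
Qed.

Lemma square_sum_Cauchy_product a b n :
  square_sum (Cauchy_product a b) n =
  \sum_(k < n) \sum_(k' < n | (k + k' < n)%N)
    \sum_(l < n) \sum_(l' < n | (l + l' < n)%N) a k l * b k' l'.
Proof.
rewrite -(sum_antidiagonal (fun k k' => \sum_(l < n)
  \sum_(l' < n | (l + l' < n)%N) a k l * b k' l')).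
apply: eq_bigr => i _; rewrite exchange_big/=; apply: eq_bigr => k _.
by rewrite -(sum_antidiagonal (fun l l' => a k l * b (i - k)%N l')).
Qed.

Lemma square_sumM a b n : square_sum a n * square_sum b n =
  \sum_(k < n) \sum_(k' < n) \sum_(l < n) \sum_(l' < n) a k l * b k' l'.
Proof.
rewrite /square_sum big_distrlr/=; apply: eq_bigr => k _.
by apply: eq_bigr => k' _; rewrite big_distrlr.
Qed.

(** The product of two square sums and the square sum of the Cauchy product differ by the terms with
    [k + k' >= n] or [l + l' >= n]. The ratio 1/4 is used as 1/2 times 1/2: one half makes the
    difference at most a multiple of [2^-1 ^+ n], the other sums over the four indices. *)
Lemma square_sum_Cauchy_product_cvg M (N : R[i]) a b (la lb : R[i]) :
  (forall i j, `|a i j| <= M * 4^-1 ^+ (i + j)) ->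
  (forall i j, `|b i j| <= N * 4^-1 ^+ (i + j)) ->
  square_sum a @ \oo --> la -> square_sum b @ \oo --> lb ->
  square_sum (Cauchy_product a b) @ \oo --> la * lb.
Proof.
move=> aM bN ala blb.
have M0 : 0 <= M.
  by have := aM 0%N 0%N; rewrite expr0 mulr1; apply: le_trans.
have N0 : 0 <= N.
  by have := bN 0%N 0%N; rewrite expr0 mulr1; apply: le_trans.
pose h n : R[i] := 2^-1 ^+ n.
have h0 n : 0 <= h n by exact: half_expr_ge0.
have d0 : (fun n => square_sum a n * square_sum b n -
    square_sum (Cauchy_product a b) n) @ \oo --> (0 : R[i]).
  (* One factor 2 for each of the four geometric sums. *)
  apply: (@cvgn_geometric_bound _ _ (M * N * 2 * 2 * 2 * 2)) => n.
  rewrite square_sumM square_sum_Cauchy_product -sumrB.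
  apply: (@le_trans _ _ (\sum_(k < n) \sum_(k' < n) \sum_(l < n) \sum_(l' < n)
      M * N * h n * h k * h k' * h l * h l')); last first.
    apply: (@le_trans _ _ (\sum_(k < n) \sum_(k' < n) \sum_(l < n)
      M * N * h n * 2 * h k * h k' * h l)).
      apply: ler_sum => k _; apply: ler_sum => k' _; apply: ler_sum => l _.
      rewrite -mulr_sumr.
      have -> : M * N * h n * 2 * h k * h k' * h l =
        M * N * h n * h k * h k' * h l * 2 by ring.
      by rewrite ler_wpM2l ?sum_half_expr_le// !mulr_ge0.
    apply: (@le_trans _ _ (\sum_(k < n) \sum_(k' < n)
      M * N * h n * 2 * 2 * h k * h k')).
      apply: ler_sum => k _; apply: ler_sum => k' _; rewrite -mulr_sumr.
      have -> : M * N * h n * 2 * 2 * h k * h k' =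
        M * N * h n * 2 * h k * h k' * 2 by ring.
      by rewrite ler_wpM2l ?sum_half_expr_le// !mulr_ge0.
    apply: (@le_trans _ _ (\sum_(k < n) M * N * h n * 2 * 2 * 2 * h k)).
      apply: ler_sum => k _; rewrite -mulr_sumr.
      have -> : M * N * h n * 2 * 2 * 2 * h k =
        M * N * h n * 2 * 2 * h k * 2 by ring.
      by rewrite ler_wpM2l ?sum_half_expr_le// !mulr_ge0.
    rewrite -mulr_sumr.
    have -> : M * N * 2 * 2 * 2 * 2 * 2^-1 ^+ n =
      M * N * h n * 2 * 2 * 2 * 2 by rewrite /h; ring.
    by rewrite ler_wpM2l ?sum_half_expr_le// !mulr_ge0.
  rewrite (le_trans (ler_norm_sum _ _ _))//; apply: ler_sum => k _.
  rewrite [X in _ - X]big_mkcond -sumrB/=.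
  rewrite (le_trans (ler_norm_sum _ _ _))//; apply: ler_sum => k' _.
  have -> : (if (k + k' < n)%N then \sum_(l < n) \sum_(l' < n | (l + l' < n)%N)
      a k l * b k' l' else 0) = \sum_(l < n) \sum_(l' < n)
      (if (k + k' < n)%N && (l + l' < n)%N then a k l * b k' l' else 0).
    case: ifP => _; last by rewrite big1// => l _; rewrite big1.
    by apply: eq_bigr => l _; rewrite big_mkcond.
  rewrite -sumrB (le_trans (ler_norm_sum _ _ _))//; apply: ler_sum => l _.
  rewrite -sumrB (le_trans (ler_norm_sum _ _ _))//; apply: ler_sum => l' _.
  case: ifPn => [_|c].
    by rewrite subrr normr0 !mulr_ge0.
  rewrite subr0 normrM.
  apply: (@le_trans _ _ (M * 4^-1 ^+ (k + l) * (N * 4^-1 ^+ (k' + l')))).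
    by rewrite ler_pM.
  have -> : M * 4^-1 ^+ (k + l) * (N * 4^-1 ^+ (k' + l')) =
      M * N * h k * h k' * h l * h l' * h ((k + k') + (l + l'))%N.
    have e4 : (4^-1 : R[i]) = 2^-1 * 2^-1 by field.
    by rewrite /h e4 !exprD !exprMn; ring.
  have -> : M * N * h n * h k * h k' * h l * h l' =
    M * N * h k * h k' * h l * h l' * h n by ring.
  rewrite ler_wpM2l ?mulr_ge0// half_expr_le//.
  move: c; rewrite negb_and -!leqNgt => /orP[|] c.
    by rewrite (leq_trans c)// leq_addr.
  by rewrite (leq_trans c)// leq_addl.
have -> : square_sum (Cauchy_product a b) = square_sum a * square_sum b -
    (fun n => square_sum a n * square_sum b n -
      square_sum (Cauchy_product a b) n).
  by apply/funext => n; rewrite !fctE; ring.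
by rewrite -[la * lb]subr0; exact: (cvgB (cvgM ala blb) d0).
Qed.

End DoubleSums.

(** * Taylor expansions at a point *)

Section PowerSeries.
Variable R : realType.
Implicit Types (a b : nat -> nat -> R[i]) (f g : C2 R -> R[i]) (p : C2 R).

Lemma C2_norm_lt (z : C2 R) (e : R[i]) :
  (`|z| < e) = (`|z.1| < e) && (`|z.2| < e).
Proof.
have -> : `|z| = Num.max `|z.1| `|z.2| by exact: prod_normE.
by rewrite comparable_gt_max// real_comparable// normr_real.
Qed.

Lemma near0_coord_le (e : R[i]) : 0 < e ->
  \forall z \near (0 : C2 R), `|z.1| <= e /\ `|z.2| <= e.
Proof.
move=> e0; apply/nbhs_norm0P; exists e => //= z.
move=> ze; have : `|z| < e := ze.
by rewrite C2_norm_lt => /andP[/ltW z1 /ltW z2].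
Qed.

Lemma near0_coordP (P : C2 R -> Prop) : (\forall z \near (0 : C2 R), P z) ->
  exists2 e : R[i], 0 < e & forall z, `|z.1| <= e -> `|z.2| <= e -> P z.
Proof.
move/nbhs_norm0P => [e /= e0 eP]; exists (e / 2); first by rewrite divr_gt0.
have e2 : e / 2 < e by rewrite gtr_pMr// invf_lt1// ltr1n.
move=> z z1 z2; apply: eP; suff : `|z| < e by [].
by rewrite C2_norm_lt (le_lt_trans z1 e2) (le_lt_trans z2 e2).
Qed.

Lemma near_nbhs0 p (P : C2 R -> Prop) :
  (\forall q \near p, P q) <-> (\forall z \near (0 : C2 R), P (p + z)).
Proof. exact: nbhs0P. Qed.

Lemma cvgn_norm_le (u : nat -> R[i]) (l B : R[i]) :
  (forall n, `|u n| <= B) -> u @ \oo --> l -> `|l| <= B.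
Proof.
move=> uB /cvgrPdist_le ul.
have Br : B \is Num.real by rewrite ger0_real// (le_trans _ (uB 0%N)).
rewrite real_leNgt ?normr_real//; apply/negP => Bl.
have e0 : 0 < (`|l| - B) / 2 by rewrite divr_gt0// subr_gt0.
have [N _ /(_ N (leqnn N))/= h] := ul _ e0.
have : `|l| <= (`|l| - B) / 2 + B.
  by rewrite -[l in leLHS](subrK (u N)) (le_trans (ler_normD _ _))// lerD.
rewrite -subr_ge0.
have -> : (`|l| - B) / 2 + B - `|l| = - ((`|l| - B) / 2) by field.
by rewrite oppr_ge0 => /(lt_le_trans e0); rewrite ltxx.
Qed.

Lemma is_derive_quadratic f p v (D B r : R[i]) : 0 < r ->
  (forall t, `|t| <= r -> `|f (p + t *: v) - f p - t * D| <= B * `|t| ^+ 2) ->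
  is_derive p v f D.
Proof.
move=> r0 fB.
have B0 : 0 <= B.
  have := fB r; rewrite gtr0_norm// => /(_ (lexx _)) h.
  by move: (le_trans (normr_ge0 _) h); rewrite pmulr_lge0// exprn_gt0.
suff h : (fun h => h^-1 *: ((f \o shift p) (h *: v) - f p)) @ 0^' --> D.
  apply: DeriveDef; first by apply/cvg_ex; exists D.
  exact: (cvg_lim _ h).
apply/cvgrPdist_le => e e0.
(* [B] may be 0, so the radius is taken with [B + 1] in the denominator. *)
have B1 : 0 < B + 1 by rewrite (le_lt_trans B0)// ltrDl.
have eB : 0 < e / (B + 1) by rewrite divr_gt0.
have n1 : \forall t \near (0:R[i])^', `|t| <= r.
  apply: nbhs_dnbhs; apply/nbhs_norm0P; exists r => //= t; exact: ltW.
have n2 : \forall t \near (0:R[i])^', `|t| <= e / (B + 1).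
  by apply: nbhs_dnbhs; apply/nbhs_norm0P; exists (e / (B + 1)) => //= t; exact: ltW.
have n3 : \forall t \near (0:R[i])^', t != 0 by exact: nbhs_dnbhs_neq.
apply: filterS3 n1 n2 n3 => t tr te t0 /=.
rewrite [t *: v + p]addrC.
have -> : D - t^-1 *: (f (p + t *: v) - f p) =
   - (t^-1 * (f (p + t *: v) - f p - t * D)).
  by rewrite /GRing.scale/=; field.
rewrite normrN normrM normfV ler_pdivrMl ?normr_gt0//.
rewrite (le_trans (fB _ tr))// expr2 mulrCA ler_wpM2l// mulrC.
apply: (@le_trans _ _ (e / (B + 1) * B)); first by rewrite ler_wpM2r.
by rewrite mulrAC ler_pdivrMr// ler_wpM2l ?(ltW e0)// lerDl.
Qed.

Definition geometric_coefs a := exists M K : R[i],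
  0 < K /\ forall i j, `|a i j| <= M * K ^+ (i + j).

(** The geometric bound replaces the bounded absolute sums of [power_series_to]: it does not mention
    [z] and passes easily to sums, products and derivatives. *)
Definition taylor f p a := geometric_coefs a /\
  \forall z \near (0 : C2 R),
    square_sum (power_series_term a z) @ \oo --> f (p + z).

Lemma power_series_term_le a (M K c : R[i]) z : 0 < K -> 0 < c ->
  (forall i j, `|a i j| <= M * K ^+ (i + j)) ->
  `|z.1| <= c / K -> `|z.2| <= c / K ->
  forall i j, `|power_series_term a z i j| <= M * c ^+ (i + j).
Proof.
move=> K0 c0 aM z1 z2 i j.
have M0 : 0 <= M.
  by have := aM 0%N 0%N; rewrite expr0 mulr1; apply: le_trans.
rewrite /power_series_term !normrM !normrX.
have -> : M * c ^+ (i + j) = M * K ^+ (i + j) * (c / K) ^+ i * (c / K) ^+ j.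
  rewrite -[RHS]mulrA -exprD expr_div_n -mulrA; congr (_ * _).
  by rewrite mulrC divfK// expf_neq0// gt_eqF.
by rewrite !ler_pM ?mulr_ge0 ?exprn_ge0// lerXn2r// nnegrE divr_ge0// ltW.
Qed.

Lemma near0_power_series_term_le a (c : R[i]) : 0 < c -> geometric_coefs a ->
  exists M : R[i], \forall z \near (0 : C2 R),
    forall i j, `|power_series_term a z i j| <= M * c ^+ (i + j).
Proof.
move=> c0 [M [K [K0 aM]]]; exists M.
have := @near0_coord_le (c / K) (divr_gt0 c0 K0).
by apply: filterS => z [z1 z2]; exact: (power_series_term_le K0 c0 aM z1 z2).
Qed.

Lemma near_andP p (P Q : C2 R -> Prop) :
  ((\forall q \near p, P q) /\ (\forall q \near p, Q q)) <->
  \forall q \near p, P q /\ Q q.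
Proof.
split=> [[]|PQ]; first exact: filterS2.
by split; apply: filterS PQ => q [].
Qed.

Lemma half_gt0 : 0 < (2^-1 : R[i]). Proof. by rewrite invr_gt0. Qed.

Lemma has_power_series_atP f p :
  has_power_series_at f p <-> exists a, taylor f p a.
Proof.
split=> -[a].
  move=> aps; exists a; split; last by apply: filterS aps => z [].
  have [e e0 ez] := near0_coordP aps.
  (* At the corner [(e, e)] every single term is at most the bound [M] of the absolute sums, which
     is a Cauchy estimate for the coefficients. *)
  have [] := ez (e, e).
  - by rewrite /= gtr0_norm.
  - by rewrite /= gtr0_norm.
  move=> [M aM] _; exists M, e^-1; split; first by rewrite invr_gt0.
  move=> i j; rewrite exprVn ler_pdivlMr ?exprn_gt0//.
  (* The square of side [(i + j).+1] is large enough to contain the index [(i, j)]. *)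
  apply: le_trans (aM (i + j).+1).
  have hi : (i < (i + j).+1)%N by rewrite ltnS leq_addr.
  have hj : (j < (i + j).+1)%N by rewrite ltnS leq_addl.
  rewrite (bigD1 (Ordinal hi))//= (bigD1 (Ordinal hj))//=.
  rewrite /power_series_term !normrM !normrX/= (gtr0_norm e0) -!mulrA -exprD.
  rewrite -addrA lerDl addr_ge0//; apply: sumr_ge0 => k _ //.
  exact: sumr_ge0.
move=> [ga fa]; exists a.
have [M aM] := near0_power_series_term_le half_gt0 ga.
apply: filterS2 fa aM => z fz zM; split => //.
by exists (M * 2 * 2) => n; exact: half_bounded_abs_sum.
Qed.

Lemma ler_mul_expr (M K L : R[i]) n : 0 <= M -> 0 <= K -> K <= L ->
  M * K ^+ n <= M * L ^+ n.
Proof.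
by move=> M0 K0 KL; rewrite ler_wpM2l// lerXn2r// nnegrE (le_trans K0 KL).
Qed.

Lemma taylor_radius f p a : taylor f p a -> exists M K : R[i],
  [/\ 0 <= M, 0 < K, forall i j, `|a i j| <= M * K ^+ (i + j) &
    forall z, `|z.1| <= K^-1 -> `|z.2| <= K^-1 ->
      square_sum (power_series_term a z) @ \oo --> f (p + z)].
Proof.
move=> [[M [K [K0 aM]]] /near0_coordP[e e0 ez]].
have M0 : 0 <= M.
  by have := aM 0%N 0%N; rewrite expr0 mulr1; apply: le_trans.
have Ke0 : 0 < K + e^-1 by rewrite addr_gt0// invr_gt0.
(* Enlarging [K] keeps the coefficient bound and brings the radius [K^-1] below [e], so a single
   constant serves both purposes. *)
exists M, (K + e^-1); split => //.
  move=> i j; rewrite (le_trans (aM i j))// ler_mul_expr// ?(ltW K0)//.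
  by rewrite lerDl invr_ge0 ltW.
have h : (K + e^-1)^-1 <= e.
  by rewrite invf_ple ?posrE// lerDr ltW.
by move=> z z1 z2; apply: ez; exact: le_trans h.
Qed.

Lemma taylor_eq f g p a : (\forall q \near p, f q = g q) ->
  taylor f p a -> taylor g p a.
Proof.
move=> fg [ga fa]; split; first exact: ga.
have fg0 := (near_nbhs0 p (fun q => f q = g q)).1 fg.
by apply: filterS2 fg0 fa => z <-.
Qed.

Lemma geometric_coefsP a (M K : R[i]) : 0 <= M -> 0 <= K ->
  (forall i j, `|a i j| <= M * K ^+ (i + j)) -> geometric_coefs a.
Proof.
move=> M0 K0 aM; exists M, (K + 1); split; first by rewrite (le_lt_trans K0)// ltrDl.
by move=> i j; rewrite (le_trans (aM i j))// ler_mul_expr// lerDl.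
Qed.

Lemma taylorD f g p a b : taylor f p a -> taylor g p b ->
  taylor (f + g) p (fun i j => a i j + b i j).
Proof.
move=> ta tb.
have [M [K [M0 K0 aM _]]] := taylor_radius ta.
have [N [L [N0 L0 bN _]]] := taylor_radius tb.
split.
  apply: (@geometric_coefsP _ (M + N) (K + L)).
  - by rewrite addr_ge0.
  - by rewrite addr_ge0// ltW.
  move=> i j; rewrite mulrDl (le_trans (ler_normD _ _))// lerD//.
    by rewrite (le_trans (aM i j))// ler_mul_expr// ?lerDl ltW.
  by rewrite (le_trans (bN i j))// ler_mul_expr// ?lerDr ltW.
apply: filterS2 ta.2 tb.2 => z fa gb.
have -> : square_sum (power_series_term (fun i j => a i j + b i j) z) =
    square_sum (power_series_term a z) + square_sum (power_series_term b z).
  apply/funext => n; rewrite !fctE /square_sum -big_split; apply: eq_bigr => i _.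
  rewrite -big_split; apply: eq_bigr => j _.
  by rewrite /power_series_term !mulrDl.
exact: (cvgD fa gb).
Qed.

Lemma succ_le_expr2 n : (n.+1%:R : R[i]) <= 2 ^+ n.
Proof. by rewrite -natrX ler_nat ltn_expl. Qed.

Lemma taylorM f g p a b : taylor f p a -> taylor g p b ->
  taylor (f * g) p (Cauchy_product a b).
Proof.
move=> ta tb.
have [M [K [M0 K0 aM _]]] := taylor_radius ta.
have [N [L [N0 L0 bN _]]] := taylor_radius tb.
have KL0 : 0 < K + L by rewrite addr_gt0.
split.
  (* The Cauchy product has [i.+1 * j.+1] summands, at most [2 ^+ (i + j)], which doubles the
     rate. *)
  apply: (@geometric_coefsP _ (M * N) (2 * (K + L))).
  - by rewrite mulr_ge0.
  - by rewrite mulr_ge0// ltW.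
  move=> i j.
  rewrite (le_trans (ler_norm_sum _ _ _))//.
  apply: (@le_trans _ _ (\sum_(k < i.+1) \sum_(l < j.+1) M * N * (K + L) ^+ (i + j))).
    apply: ler_sum => k _; rewrite (le_trans (ler_norm_sum _ _ _))//.
    apply: ler_sum => l _; rewrite normrM.
    have ki : (k <= i)%N by rewrite -ltnS.
    have lj : (l <= j)%N by rewrite -ltnS.
    have -> : M * N * (K + L) ^+ (i + j) =
        M * (K + L) ^+ (k + l) * (N * (K + L) ^+ (i - k + (j - l))).
      rewrite mulrACA -exprD; congr (_ * _ ^+ _).
      by rewrite addnACA subnKC// subnKC.
    rewrite ler_pM//.
      by rewrite (le_trans (aM _ _))// ler_mul_expr// ?lerDl ltW.
    by rewrite (le_trans (bN _ _))// ler_mul_expr// ?lerDr ltW.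
  rewrite !sumr_const !card_ord -mulrnA -[leLHS]mulr_natr -[leLHS]mulrA ler_wpM2l ?mulr_ge0//.
  rewrite exprMn mulrC ler_wpM2r ?exprn_ge0 ?(ltW KL0)//.
  by rewrite mulnC natrM exprD ler_pM// succ_le_expr2.
have q0 : 0 < (4^-1 : R[i]) by rewrite invr_gt0.
have [M' aM'] := near0_power_series_term_le q0 ta.1.
have [N' bN'] := near0_power_series_term_le q0 tb.1.
have h := (near_andP _ _ _).1 (conj aM' bN').
apply: filterS3 ta.2 tb.2 h => z fa gb [az bz].
have -> : power_series_term (Cauchy_product a b) z =
    Cauchy_product (power_series_term a z) (power_series_term b z).
  apply/funext => i; apply/funext => j.
  rewrite /power_series_term /Cauchy_product !mulr_suml; apply: eq_bigr => k _.
  rewrite !mulr_suml; apply: eq_bigr => l _.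
  have ki : (k <= i)%N by rewrite -ltnS.
  have lj : (l <= j)%N by rewrite -ltnS.
  have -> : z.1 ^+ i = z.1 ^+ k * z.1 ^+ (i - k) by rewrite -exprD subnKC.
  have -> : z.2 ^+ j = z.2 ^+ l * z.2 ^+ (j - l) by rewrite -exprD subnKC.
  by ring.
exact: (square_sum_Cauchy_product_cvg az bz fa gb).
Qed.

(** Conjugation by this exchange transports results on the first coordinate and [dx] to the second
    coordinate and [dy]. *)
Definition swap (q : C2 R) : C2 R := (q.2, q.1).

Lemma taylor_swap f p a : taylor f p a ->
  taylor (f \o swap) (swap p) (fun i j => a j i).
Proof.
move=> ta; have [M [K [M0 K0 aM faz]]] := taylor_radius ta; split.
  by exists M, K; split => // i j; rewrite addnC.
have K0' : 0 < K^-1 by rewrite invr_gt0.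
apply: filterS (near0_coord_le K0') => z [z1 z2].
have := faz (swap z) z2 z1.
have -> : square_sum (power_series_term a (swap z)) =
    square_sum (power_series_term (fun i j => a j i) z).
  apply/funext => n; rewrite /square_sum exchange_big; apply: eq_bigr => i _.
  by apply: eq_bigr => j _; rewrite /power_series_term mulrAC.
by [].
Qed.

End PowerSeries.

(** * Termwise differentiation of power series *)

Section Derivatives.
Variable R : realType.
Implicit Types (a b : nat -> nat -> R[i]) (f g : C2 R -> R[i]) (p : C2 R).

Definition coefs_dx a : nat -> nat -> R[i] := fun i j => i.+1%:R * a i.+1 j.

(** The second-order remainders satisfy $R_{i+1} = (z+t)R_i + t^2 i z^{i-1}$. In the induction each
    of the two terms contributes a factor $2r$, whence the rate $4r$. *)
Lemma expr_increment_le (z t r : R[i]) (i : nat) : 0 < r -> `|z| <= r -> `|t| <= r ->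
  `|(z + t) ^+ i - z ^+ i - t * (i%:R * z ^+ i.-1)| <=
  `|t| ^+ 2 / r ^+ 2 * (4 * r) ^+ i.
Proof.
move=> r0 zr tr; elim: i => [|i IH].
  rewrite !expr0 subrr mul0r mulr0 subr0 normr0 mulr1 divr_ge0 ?exprn_ge0//.
  exact: ltW.
have -> : (z + t) ^+ i.+1 - z ^+ i.+1 - t * (i.+1%:R * z ^+ i.+1.-1) =
  (z + t) * ((z + t) ^+ i - z ^+ i - t * (i%:R * z ^+ i.-1)) +
  t ^+ 2 * (i%:R * z ^+ i.-1).
  case: i {IH} => [|i] /=; first by rewrite !expr1 !expr0; ring.
  by rewrite -[i.+2%:R]natr1 [_ ^+ i.+2]exprS [z ^+ i.+2]exprS [z ^+ i.+1]exprS; ring.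
rewrite (le_trans (ler_normD _ _))// normrM [`|t ^+ 2 * _|]normrM [`|t ^+ 2|]normrX.
have zt : `|z + t| <= 2 * r.
  by rewrite (le_trans (ler_normD _ _))// mulr2n mulrDl mul1r lerD.
have h : `|i%:R * z ^+ i.-1| <= 2 * r / r ^+ 2 * (4 * r) ^+ i.
  rewrite normrM normr_nat normrX.
  case: i {IH} => [|i].
    by rewrite mul0r mulr_ge0// ?divr_ge0// ?mulr_ge0// ?exprn_ge0// ?mulr_ge0// ltW.
  have -> : 2 * r / r ^+ 2 * (4 * r) ^+ i.+1 = (2 * 4 ^+ i.+1) * r ^+ i.
    by rewrite exprMn [r ^+ i.+1]exprS; field; rewrite gt_eqF.
  rewrite ler_pM ?exprn_ge0//; last by rewrite lerXn2r// nnegrE ltW.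
  by rewrite -natrX -natrM ler_nat (leq_trans (ltnW (ltn_expl i.+1 (isT : 1 < 4)%N)))//
    leq_pmull.
apply: (@le_trans _ _ (2 * r * (`|t| ^+ 2 / r ^+ 2 * (4 * r) ^+ i) +
    `|t| ^+ 2 * (2 * r / r ^+ 2 * (4 * r) ^+ i))).
  rewrite lerD//; first by rewrite ler_pM.
  by rewrite ler_wpM2l// exprn_ge0.
rewrite le_eqVlt; apply/orP; left; apply/eqP.
by rewrite [(4 * r) ^+ i.+1]exprS; field; rewrite gt_eqF.
Qed.

Lemma cvgn_succ (u : nat -> R[i]) (l : R[i]) :
  u @ \oo --> l <-> (fun n => u n.+1) @ \oo --> l.
Proof. by rewrite -(cvg_shiftS u). Qed.

Lemma rectangle_sum_cvg_tr (M : R[i]) a (l : R[i]) : half_bounded M a ->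
  square_sum a @ \oo --> l ->
  (fun n => \sum_(i < n) \sum_(j < n.+1) a i j) @ \oo --> l.
Proof.
move=> aM al.
have tr (b : nat -> nat -> R[i]) (m n : nat) :
    \sum_(i < m) \sum_(j < n) b i j = \sum_(j < n) \sum_(i < m) b i j.
  by rewrite exchange_big.
have -> : (fun n => \sum_(i < n) \sum_(j < n.+1) a i j) =
    (fun n => \sum_(j < n.+1) \sum_(i < n) a i j).
  by apply/funext => n; rewrite tr.
apply: (rectangle_sum_cvg (half_bounded_tr aM)).
have -> : square_sum (fun i j => a j i) = square_sum a => //.
by apply/funext => n; rewrite /square_sum tr.
Qed.

Lemma geometric_coefs_dx a (M K : R[i]) : 0 <= M -> 0 < K ->
  (forall i j, `|a i j| <= M * K ^+ (i + j)) ->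
  forall i j, `|coefs_dx a i j| <= M * K * (2 * K) ^+ (i + j).
Proof.
move=> M0 K0 aM i j; rewrite /coefs_dx normrM normr_nat.
have -> : M * K * (2 * K) ^+ (i + j) = 2 ^+ (i + j) * (M * K ^+ (i.+1 + j)).
  by rewrite addSn exprS exprMn; ring.
rewrite ler_pM// (le_trans (succ_le_expr2 _ i))// ler_weXn2l ?ler1n//.
exact: leq_addr.
Qed.

(** The remainder of first order of every partial sum is bounded by a constant times $|t|^2$,
    uniformly in its size. The bound survives the limit, and a quadratic remainder identifies the
    derivative. *)
Lemma taylor_dx f p a : taylor f p a ->
  taylor (dx f) p (coefs_dx a) /\
  \forall z \near (0 : C2 R), derivable f (p + z) (1, 0).
Proof.
move=> ta; have [M [K [M0 K0 aM fz]]] := taylor_radius ta.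
have da := geometric_coefs_dx M0 K0 aM.
have MK0 : 0 <= M * K by rewrite mulr_ge0// ltW.
have K20 : 0 < 2 * K by rewrite mulr_gt0.
(* This radius gives [K * (4 * r) = 2^-1], the ratio needed after [expr_increment_le], and keeps
   [z + t] in the polydisc of radius [K^-1]. *)
pose r := (8 * K)^-1.
have r0 : 0 < r by rewrite invr_gt0 mulr_gt0.
have h0 : 0 < (2^-1 : R[i]) by rewrite invr_gt0.
have key : forall z : C2 R, `|z.1| <= r -> `|z.2| <= r ->
    exists D, square_sum (power_series_term (coefs_dx a) z) @ \oo --> D /\
      is_derive (p + z) ((1, 0) : C2 R) f D.
  move=> z z1 z2.
  have rK : r <= 2^-1 / (2 * K).
    by rewrite /r -invfM lef_pV2 ?posrE ?mulr_gt0// mulrA ler_wpM2r ?(ltW K0)//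
      -natrM ler_nat.
  have rK1 : r + r <= K^-1.
    rewrite /r -subr_ge0.
    have -> : K^-1 - ((8 * K)^-1 + (8 * K)^-1) = 3 / 4 / K by field; rewrite gt_eqF.
    by rewrite !divr_ge0// ltW.
  have rK2 : r <= K^-1 by rewrite (le_trans _ rK1)// lerDl ltW.
  have bnd := power_series_term_le K20 h0 da (le_trans z1 rK) (le_trans z2 rK).
  have [D SD] := square_sum_cvg bnd.
  exists D; split; first exact: SD.
  apply: (@is_derive_quadratic _ _ _ _ _ (M * 2 * 2 / r ^+ 2) r r0) => t tr.
  (* The derivative of row i+1 is row i of [coefs_dx], so the differentiated sum has one row fewer.
     Only [u n.+1] is used, so the predecessors are harmless. *)
  pose u n := square_sum (power_series_term a (z + t *: ((1, 0) : C2 R))) n -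
     square_sum (power_series_term a z) n -
     t * \sum_(i < n.-1) \sum_(j < n.-1.+1) power_series_term (coefs_dx a) z i j.
  have zt : z + t *: ((1, 0) : C2 R) = (z.1 + t, z.2).
    by case: (z) => x y; congr pair; rewrite /= /GRing.scale/= ?mulr1 ?mulr0 ?addr0.
  have cu : (fun n => u n.+1) @ \oo -->
      f (p + z + t *: ((1, 0) : C2 R)) - f (p + z) - t * D.
    have c1 : (fun n => square_sum (power_series_term a (z + t *: ((1, 0) : C2 R))) n.+1)
        @ \oo --> f (p + z + t *: ((1, 0) : C2 R)).
      apply: (cvgn_succ (square_sum _) _).1; rewrite -addrA; apply: fz; rewrite zt/=.
        by rewrite (le_trans (ler_normD _ _))// (le_trans _ rK1)// lerD.
      exact: le_trans rK2.
    have c2 : (fun n => square_sum (power_series_term a z) n.+1) @ \oo --> f (p + z).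
      by apply: (cvgn_succ (square_sum _) _).1; apply: fz; [exact: le_trans rK2|exact: le_trans rK2].
    have c3 := rectangle_sum_cvg_tr bnd SD.
    have ct : (fun _ : nat => t) @ \oo --> t by exact: cvg_cst.
    exact: (cvgB (cvgB c1 c2) (cvgM ct c3)).
  apply: cvgn_norm_le cu => n.
  rewrite /u zt /square_sum/=.
  (* Reindexed by i+1, the sum regains a full square; the added row i = 0 vanishes through the
     factor [i%:R]. *)
  have -> : t * (\sum_(i < n) \sum_(j < n.+1) power_series_term (coefs_dx a) z i j) =
    \sum_(i < n.+1) \sum_(j < n.+1) t * (a i j * (i%:R * z.1 ^+ i.-1) * z.2 ^+ j).
    rewrite [RHS]big_ord_recl [X in _ = X + _]big1 ?add0r; last first.
      by move=> j _; rewrite mul0r mulr0 mul0r mulr0.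
    rewrite mulr_sumr; apply: eq_bigr => i _; rewrite mulr_sumr.
    apply: eq_bigr => j _; rewrite /power_series_term /coefs_dx /=.
    by rewrite /bump/= add1n; ring.
  rewrite -!sumrB.
  apply: (@le_trans _ _ (\sum_(i < n.+1) \sum_(j < n.+1)
     M * (`|t| ^+ 2 / r ^+ 2) * 2^-1 ^+ i * 2^-1 ^+ j)); last first.
    have -> : M * 2 * 2 / r ^+ 2 * `|t| ^+ 2 = M * (`|t| ^+ 2 / r ^+ 2) * 2 * 2 by ring.
    have B0 : 0 <= M * (`|t| ^+ 2 / r ^+ 2).
      by rewrite mulr_ge0// divr_ge0// ?exprn_ge0// ltW.
    apply: (@le_trans _ _ (\sum_(i < n.+1) M * (`|t| ^+ 2 / r ^+ 2) * 2 * 2^-1 ^+ i)).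
      apply: ler_sum => i _; rewrite -mulr_sumr [leRHS]mulrAC ler_wpM2l//.
        by rewrite mulr_ge0// half_expr_ge0.
      exact: sum_half_expr_le.
    by rewrite -mulr_sumr ler_wpM2l ?sum_half_expr_le// mulr_ge0.
  rewrite (le_trans (ler_norm_sum _ _ _))//; apply: ler_sum => i _.
  rewrite -!sumrB.
  rewrite (le_trans (ler_norm_sum _ _ _))//; apply: ler_sum => j _.
  rewrite /power_series_term/=.
  have -> : a i j * (z.1 + t) ^+ i * z.2 ^+ j - a i j * z.1 ^+ i * z.2 ^+ j -
      t * (a i j * (i%:R * z.1 ^+ i.-1) * z.2 ^+ j) =
    a i j * ((z.1 + t) ^+ i - z.1 ^+ i - t * (i%:R * z.1 ^+ i.-1)) * z.2 ^+ j by ring.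
  rewrite !normrM.
  apply: (@le_trans _ _ (M * K ^+ (i + j) * (`|t| ^+ 2 / r ^+ 2 * (4 * r) ^+ i) *
      r ^+ j)).
    rewrite ler_pM ?mulr_ge0//.
      by rewrite ler_pM// expr_increment_le.
    by rewrite normrX lerXn2r// nnegrE ltW.
  have e1 : K * (4 * r) = 2^-1.
    by rewrite /r; field; rewrite gt_eqF.
  have -> : M * K ^+ (i + j) * (`|t| ^+ 2 / r ^+ 2 * (4 * r) ^+ i) * r ^+ j =
     M * (`|t| ^+ 2 / r ^+ 2) * 2^-1 ^+ i * (K * r) ^+ j.
    by rewrite -e1 exprD !exprMn; ring.
  rewrite ler_wpM2l//.
    by rewrite !mulr_ge0// ?half_expr_ge0// invr_ge0 exprn_ge0// ltW.
  have Kr : K * r <= 2^-1.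
    by rewrite -e1 ler_wpM2l ?(ltW K0)// ler_peMl ?(ltW r0)// ler1n.
  have Kr0 : 0 <= K * r by rewrite mulr_ge0// ltW.
  by rewrite lerXn2r// nnegrE (le_trans Kr0).
have nr := near0_coord_le r0.
split; last first.
  apply: filterS nr => z [z1 z2]; have [D [_ dD]] := key z z1 z2.
  exact: ex_derive.
split; first by exists (M * K), (2 * K).
apply: filterS nr => z [z1 z2]; have [D [SD dD]] := key z z1 z2.
by rewrite /dx derive_val.
Qed.

End Derivatives.

(** * Uniqueness of coefficients, basic expansions, division by the first coordinate *)

Section TaylorExamples.
Variable R : realType.
Implicit Types (a b : nat -> nat -> R[i]) (f g : C2 R -> R[i]) (p : C2 R).

Lemma taylor00 f p a : taylor f p a -> a 0%N 0%N = f p.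
Proof.
(* The square sum of size 0 is empty; the sums are constant only from size 1 on. *)
move=> ta; have := nbhs_singleton ta.2; rewrite addr0 => /cvgn_succ s0.
have e : (fun n => square_sum (power_series_term a 0) n.+1) = (fun _ : nat => a 0%N 0%N).
  apply/funext => n; rewrite /square_sum big_ord_recl [X in _ + X]big1 ?addr0.
    rewrite big_ord_recl [X in _ + X]big1 ?addr0; first by rewrite /power_series_term !expr0 !mulr1.
    by move=> i _; rewrite /power_series_term /= /bump/= add1n [0 ^+ i.+1]exprS mul0r mulr0.
  move=> i _; apply: big1 => j _.
  by rewrite /power_series_term /= /bump/= add1n [0 ^+ i.+1]exprS mul0r mulr0 mul0r.
rewrite e in s0.
have c0 : (fun _ : nat => a 0%N 0%N) @ \oo --> a 0%N 0%N by exact: cvg_cst.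
exact: (cvg_unique _ c0 s0).
Qed.

Lemma near_dx_eq f g p : (\forall q \near p, f q = g q) ->
  \forall q \near p, dx f q = dx g q.
Proof.
move=> /near_join fg; apply: filterS fg => q fgq.
have v0 : ((1, 0) : C2 R) != 0 by rewrite xpair_eqE oner_eq0.
by apply: near_eq_derive.
Qed.

Lemma near_dx0 f p : (\forall q \near p, f q = 0) -> \forall q \near p, dx f q = 0.
Proof.
move=> f0; have := @near_dx_eq f (cst 0) p f0; apply: filterS => q ->.
exact: derive_cst.
Qed.

Lemma C2_nearW p (P : C2 R -> Prop) : (forall q, P q) -> \forall q \near p, P q.
Proof.
by move=> h; apply/near_nbhs0; apply: filterS (near0_coord_le (@ltr01 R[i])) => z _.
Qed.

Lemma near_swap p (P : C2 R -> Prop) : (\forall q \near p, P q) ->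
  \forall q \near swap p, P (swap q).
Proof.
move=> /near_nbhs0/near0_coordP[e e0 eP]; apply/near_nbhs0.
apply: filterS (near0_coord_le e0) => z [z1 z2].
have -> : swap (swap p + z) = p + swap z by [].
exact: eP.
Qed.

Lemma near_fst0 p (P : C2 R -> Prop) : (\forall q \near p, P q) ->
  \forall q \near p, P (p.1, q.2).
Proof.
move=> /near_nbhs0/near0_coordP[e e0 eP]; apply/near_nbhs0.
apply: filterS (near0_coord_le e0) => z [z1 z2].
have -> : (p.1, (p + z).2) = p + ((0, z.2) : C2 R).
  by rewrite -[LHS]/(p.1, p.2 + z.2) -[RHS]/(p.1 + 0, p.2 + z.2) addr0.
by apply: eP => //=; rewrite normr0 ltW.
Qed.

(** Up to a nonzero factorial, a coefficient is an iterated derivative at [p]. Applying [dx] lowers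
    the first index; for index 0 the coordinates are exchanged and the same argument is run along
    [row]. *)
Lemma taylor_eq0 f p a : taylor f p a -> (\forall q \near p, f q = 0) ->
  forall i j, a i j = 0.
Proof.
have row f' p' a' : taylor f' p' a' -> (\forall q \near p', f' q = 0) ->
    forall i, a' i 0%N = 0.
  move=> ta f0 i; elim: i f' a' ta f0 => [|i IH] f' a' ta f0.
    by rewrite (taylor00 ta) (nbhs_singleton f0).
  have [tdx _] := taylor_dx ta.
  have /eqP := IH _ _ tdx (near_dx0 f0).
  by rewrite mulf_eq0 pnatr_eq0/= => /eqP.
have col f' p' a' : taylor f' p' a' -> (\forall q \near p', f' q = 0) ->
    forall j, a' 0%N j = 0.
  move=> ta f0 j.
  exact: (row _ _ _ (taylor_swap ta) (near_swap f0) j).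
move=> ta f0 i; elim: i f a ta f0 => [|i IH] f a ta f0 j; first exact: col f0 j.
have [tdx _] := taylor_dx ta.
have /eqP := IH _ _ tdx (near_dx0 f0) j.
by rewrite mulf_eq0 pnatr_eq0/= => /eqP.
Qed.

Lemma taylor_monomial p (c : R[i]) (k l : nat) :
  taylor (fun q => c * (q - p).1 ^+ k * (q - p).2 ^+ l) p
    (fun i j => if (i == k) && (j == l) then c else 0).
Proof.
split.
  exists `|c|, 1; split => // i j; rewrite expr1n mulr1.
  by case: ifP => // _; rewrite normr0.
apply: C2_nearW => z.
rewrite [p + z]addrC addrK.
apply/cvgrPdist_le => e e0.
exists (k + l).+1 => //= n; rewrite /= => kln.
have kn : (k < n)%N by rewrite (leq_trans _ kln)// ltnS leq_addr.
have ln : (l < n)%N by rewrite (leq_trans _ kln)// ltnS leq_addl.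
have -> : square_sum (power_series_term
    (fun i j => if (i == k) && (j == l) then c else 0) z) n =
    c * z.1 ^+ k * z.2 ^+ l.
  rewrite /square_sum (bigD1 (Ordinal kn))//= [X in _ + X]big1 ?addr0.
    rewrite (bigD1 (Ordinal ln))//= [X in _ + X]big1 ?addr0.
      by rewrite /power_series_term !eqxx.
    move=> j jl; rewrite /power_series_term eqxx/=.
    by rewrite ifN ?mul0r//; apply: contra jl => /eqP jl; apply/eqP/val_inj.
  move=> i ik; apply: big1 => j _; rewrite /power_series_term.
  by rewrite ifN ?mul0r// negb_and; apply/orP; left; apply: contra ik => /eqP ik;
    apply/eqP/val_inj.
by rewrite subrr normr0 ltW.
Qed.

Lemma taylor_cst p (c : R[i]) :
  taylor (fun=> c) p (fun i j => if (i == 0%N) && (j == 0%N) then c else 0).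
Proof.
apply: taylor_eq (taylor_monomial p c 0 0).
by apply: C2_nearW => q; rewrite !expr0 !mulr1.
Qed.

Lemma ex_taylor_fst p : exists a, taylor (@fst R[i] R[i]) p a.
Proof.
eexists; apply: taylor_eq (taylorD (taylor_cst p p.1) (taylor_monomial p 1 1 0)).
by apply: C2_nearW => q; rewrite !fctE/= expr1 expr0 mulr1 mul1r/=; ring.
Qed.

(** Geometric series in $-z_1/b$ with $b = p_1 - c$; on $|z_1| \le |b|/2$ its ratio is at most
    1/2. *)
Lemma ex_taylor_inv_fst p (c : R[i]) : p.1 != c ->
  exists a, taylor (fun q => (q.1 - c)^-1) p a.
Proof.
rewrite -subr_eq0; set b := p.1 - c => b0.
exists (fun i j => if j == 0%N then b^-1 * (- b^-1) ^+ i else 0).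
split.
  apply: (@geometric_coefsP _ _ `|b^-1| (1 + `|b^-1|)) => //.
  move=> i j; case: ifP => _; last by rewrite normr0 mulr_ge0// exprn_ge0// addr_ge0.
  rewrite normrM normrX normrN ler_wpM2l//.
  apply: (@le_trans _ _ ((1 + `|b^-1|) ^+ i)).
    by rewrite lerXn2r ?nnegrE ?addr_ge0// lerDr.
  by rewrite ler_weXn2l ?lerDl// leq_addr.
have b2 : 0 < `|b| / 2 by rewrite divr_gt0// normr_gt0.
apply: filterS (near0_coord_le b2) => z [z1 _].
pose r := - (z.1 / b).
have rh : `|r| <= 2^-1.
  by rewrite normrN normrM normfV ler_pdivrMr ?normr_gt0// mulrC.
have r1 : 1 - r != 0.
  apply/eqP => /eqP; rewrite subr_eq0 => /eqP r1.
  by move: rh; rewrite -r1 normr1 lt_geF// invf_lt1// ltr1n.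
have bz : p.1 + z.1 - c != 0.
  have -> : p.1 + z.1 - c = b * (1 - r) by rewrite /r /b; field.
  by rewrite mulf_neq0.
apply/cvgn_succ.
pose u n := square_sum (power_series_term
  (fun i j => if j == 0%N then b^-1 * (- b^-1) ^+ i else 0) z) n.+1.
have uE n : u n = (p.1 + z.1 - c)^-1 * (1 - r ^+ n.+1).
  have -> : u n = b^-1 * \sum_(i < n.+1) r ^+ i.
    rewrite mulr_sumr; apply: eq_bigr => i _; rewrite big_ord_recl.
    rewrite [X in _ + X]big1 ?addr0.
      rewrite /power_series_term/= expr0 mulr1 -mulrA -exprMn /r.
      by congr (_ * _ ^+ _); ring.
    by move=> j _; rewrite /power_series_term /= mul0r mul0r.
  have e1 : 1 - r ^+ n.+1 = (1 - r) * \sum_(i < n.+1) r ^+ i.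
    by rewrite -[LHS]opprB subrX1; ring.
  have e2 : p.1 + z.1 - c = b * (1 - r) by rewrite /r /b; field.
  by rewrite e1 e2; field; apply/andP.
have <- : p.1 + z.1 - c = (p + z).1 - c by [].
apply/cvgrPdist_le => e e0.
have : (fun n => (p.1 + z.1 - c)^-1 - u n) @ \oo --> (0 : R[i]).
  apply: (@cvgn_geometric_bound _ _ `|(p.1 + z.1 - c)^-1|) => n.
  rewrite uE.
  have -> : (p.1 + z.1 - c)^-1 - (p.1 + z.1 - c)^-1 * (1 - r ^+ n.+1) =
     (p.1 + z.1 - c)^-1 * r ^+ n.+1 by ring.
  rewrite normrM ler_wpM2l// normrX.
  apply: (@le_trans _ _ (2^-1 ^+ n.+1)).
    by rewrite lerXn2r// nnegrE ?invr_ge0.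
  by apply: half_expr_le.
by move/cvgr0Pnorm_le => /(_ _ e0).
Qed.

Lemma taylor_fst0 f p a : taylor f p a ->
  taylor (fun q => f (p.1, q.2)) p (fun i j => if i == 0%N then a 0%N j else 0).
Proof.
move=> ta; have [M [K [M0 K0 aM fz]]] := taylor_radius ta; split.
  exists M, K; split => // i j; case: ifP => [/eqP ->|_]; first exact: aM.
  by rewrite normr0 mulr_ge0// exprn_ge0// ltW.
have iK0 : 0 < K^-1 by rewrite invr_gt0.
apply: filterS (near0_coord_le iK0) => z [z1 z2].
have -> : (p.1, (p + z).2) = p + ((0, z.2) : C2 R).
  by rewrite -[LHS]/(p.1, p.2 + z.2) -[RHS]/(p.1 + 0, p.2 + z.2) addr0.
have -> : square_sum (power_series_term (fun i j => if i == 0%N then a 0%N j else 0) z) =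
   square_sum (power_series_term a (0, z.2)).
  apply/funext => n; apply: eq_bigr => i _; apply: eq_bigr => j _.
  rewrite /power_series_term/=; case: (nat_of_ord i) => [|k]; first by rewrite !expr0.
  by rewrite [0 ^+ k.+1]exprS !mul0r mulr0 mul0r.
by apply: fz => //=; rewrite normr0 ltW.
Qed.

(* Off the line [q.1 = 0] the quotient is a product of series, on it the
   coefficients are shifted; filling in [dx f] there avoids re-expanding a power
   series at a nearby point. *)
Lemma ex_taylor_div_fst f p a : taylor f p a ->
  (\forall q \near p, q.1 = 0 -> f q = 0) ->
  exists b, taylor (fun q => if q.1 == 0 then dx f q else q.1^-1 * f q) p b.
Proof.
move=> ta f0; have [p0|p0] := eqVneq p.1 0; last first.
  have [b tb] := ex_taylor_inv_fst p0.
  eexists; apply: taylor_eq (taylorM tb ta).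
  have hp : \forall q \near p, q.1 != 0.
    apply: (near_nbhs0 p (fun q => q.1 != 0)).2.
    have np : 0 < `|p.1| / 2 by rewrite divr_gt0// normr_gt0.
    apply: filterS (near0_coord_le np) => z [z1 _]; apply/eqP => /= pz.
    have : `|p.1| <= `|p.1| / 2.
      have pE : p.1 = - z.1 by apply/eqP; rewrite -addr_eq0; apply/eqP; exact: pz.
      by rewrite [p.1 in leLHS]pE normrN.
    rewrite ler_pdivlMr// ger_pMr ?normr_gt0// => h.
    by move: h; rewrite lt_geF// ltr1n.
  apply: filterS hp => q q0; rewrite (negbTE q0).
  by rewrite -[LHS]/((q.1 - 0)^-1 * f q) subr0.
(* Row 0 is the expansion of [f] restricted to the line [q.1 = p.1 = 0], where [f] vanishes. *)
have a0 j : a 0%N j = 0.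
  have := taylor_eq0 (taylor_fst0 ta) _ 0%N j; apply.
  by apply: filterS (near_fst0 f0) => q; apply.
have [M [K [M0 K0 aM fz]]] := taylor_radius ta.
exists (fun i j => a i.+1 j); split.
  exists (M * K), K; split => // i j.
  by rewrite (le_trans (aM _ _))// addSn exprS mulrA.
have h0 : 0 < (2^-1 : R[i]) by rewrite invr_gt0.
have [N aN] := near0_power_series_term_le h0 ta.1.
have [[_ dxf] _] := taylor_dx ta.
apply: filterS3 dxf ta.2 aN => z dz az bz.
have -> : (p + z).1 = z.1 by rewrite -[LHS]/(p.1 + z.1) p0 add0r.
case: eqVneq => [z0|z0].
  have <- : square_sum (power_series_term (coefs_dx a) z) =
      square_sum (power_series_term (fun i j => a i.+1 j) z); last exact: dz.
  apply/funext => n; apply: eq_bigr => i _; apply: eq_bigr => j _.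
  rewrite /power_series_term/= /coefs_dx z0.
  case: (nat_of_ord i) => [|k]; first by rewrite mul1r.
  by rewrite [0 ^+ k.+1]exprS !mul0r !mulr0 !mul0r.
have -> : square_sum (power_series_term (fun i j => a i.+1 j) z) =
    (fun n => z.1^-1 * \sum_(i < n.+1) \sum_(j < n) power_series_term a z i j).
  apply/funext => n; rewrite big_ord_recl [X in X + _]big1 ?add0r; last first.
    by move=> j _; rewrite /power_series_term a0 !mul0r.
  rewrite mulr_sumr; apply: eq_bigr => i _; rewrite mulr_sumr.
  apply: eq_bigr => j _; rewrite /power_series_term /= /bump/= add1n exprS.
  by field.
have ci : (fun _ : nat => z.1^-1) @ \oo --> z.1^-1 by exact: cvg_cst.
exact: (cvgM ci (rectangle_sum_cvg bz az)).
Qed.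

End TaylorExamples.

(** * The ring of holomorphic germs *)

Section Germs.
Variable R : realType.
Implicit Types (f g u v w : C2 R -> R[i]).

Lemma holomorphic_germP f :
  holomorphic_germ f <-> \forall p \near (0 : C2 R), exists a, taylor f p a.
Proof. by split; apply: filterS => p /has_power_series_atP. Qed.

Lemma holomorphic_taylor0 f : holomorphic_germ f -> exists a, taylor f 0 a.
Proof. by move=> /nbhs_singleton /has_power_series_atP. Qed.

Lemma fct_exprE f n q : (f ^+ n) q = f q ^+ n.
Proof. by elim: n => [//|n IH]; rewrite !exprS -IH. Qed.

Lemma germ_eq_refl f : germ_eq f f.
Proof. exact: C2_nearW. Qed.

Lemma germ_eq_sym f g : germ_eq f g -> germ_eq g f.
Proof. by apply: filterS => q ->. Qed.

Lemma germ_eq_trans f g u : germ_eq f g -> germ_eq g u -> germ_eq f u.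
Proof. by apply: filterS2 => q -> ->. Qed.

Lemma germ_eqM f f' g g' : germ_eq f f' -> germ_eq g g' ->
  germ_eq (f * g) (f' * g').
Proof. by apply: filterS2 => q fq gq; rewrite !fctE fq gq. Qed.

Lemma germ_eqD f f' g g' : germ_eq f f' -> germ_eq g g' ->
  germ_eq (f + g) (f' + g').
Proof. by apply: filterS2 => q fq gq; rewrite !fctE fq gq. Qed.

Lemma holomorphic_germ_eq f g : germ_eq f g -> holomorphic_germ f ->
  holomorphic_germ g.
Proof.
move=> /near_join fg /holomorphic_germP hf; apply/holomorphic_germP.
by apply: filterS2 fg hf => p fgp [a ta]; exists a; exact: taylor_eq ta.
Qed.

Lemma holomorphic_cst (c : R[i]) : holomorphic_germ (fun=> c : R[i]).
Proof.
apply/holomorphic_germP; apply: C2_nearW => p.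
by eexists; exact: taylor_cst.
Qed.

Lemma holomorphic_fst : holomorphic_germ (@fst R[i] R[i]).
Proof.
by apply/holomorphic_germP; apply: C2_nearW => p; exact: ex_taylor_fst.
Qed.

Lemma holomorphicD f g : holomorphic_germ f -> holomorphic_germ g ->
  holomorphic_germ (f + g).
Proof.
move=> /holomorphic_germP hf /holomorphic_germP hg; apply/holomorphic_germP.
apply: filterS2 hf hg => p [a ta] [b tb].
by eexists; exact: taylorD ta tb.
Qed.

Lemma holomorphicM f g : holomorphic_germ f -> holomorphic_germ g ->
  holomorphic_germ (f * g).
Proof.
move=> /holomorphic_germP hf /holomorphic_germP hg; apply/holomorphic_germP.
apply: filterS2 hf hg => p [a ta] [b tb].
by eexists; exact: taylorM ta tb.
Qed.

Lemma holomorphicN f : holomorphic_germ f -> holomorphic_germ (- f).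
Proof.
move=> hf; apply: holomorphic_germ_eq (holomorphicM (holomorphic_cst (-1)) hf).
by apply: C2_nearW => q; rewrite !fctE mulN1r.
Qed.

Lemma holomorphicB f g : holomorphic_germ f -> holomorphic_germ g ->
  holomorphic_germ (f - g).
Proof. by move=> hf hg; exact: holomorphicD hf (holomorphicN hg). Qed.

Lemma holomorphicX f n : holomorphic_germ f -> holomorphic_germ (f ^+ n).
Proof.
move=> hf; elim: n => [|n IH]; first exact: (holomorphic_cst 1).
by rewrite exprS; exact: holomorphicM.
Qed.

Lemma holomorphic_nat n : holomorphic_germ (n%:R : C2 R -> R[i]).
Proof.
apply: holomorphic_germ_eq (holomorphic_cst n%:R); apply: C2_nearW => q.
by elim: n => [//|n IH]; rewrite -natr1 IH -natr1.
Qed.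

Lemma holomorphic_prod (I : Type) (r : seq I) (P : pred I) (F : I -> C2 R -> R[i]) :
  (forall i, holomorphic_germ (F i)) -> holomorphic_germ (\prod_(i <- r | P i) F i).
Proof.
move=> hF; apply: (big_ind (@holomorphic_germ R)); first exact: (holomorphic_cst 1).
  exact: holomorphicM.
by move=> i _; exact: hF.
Qed.

Lemma holomorphic_sum (I : Type) (r : seq I) (P : pred I) (F : I -> C2 R -> R[i]) :
  (forall i, holomorphic_germ (F i)) -> holomorphic_germ (\sum_(i <- r | P i) F i).
Proof.
move=> hF; apply: (big_ind (@holomorphic_germ R)); first exact: (holomorphic_cst 0).
  exact: holomorphicD.
by move=> i _; exact: hF.
Qed.

Lemma near0_swap (P : C2 R -> Prop) : (\forall q \near (0 : C2 R), P q) ->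
  \forall q \near (0 : C2 R), P (swap q).
Proof. exact: (@near_swap _ (0 : C2 R)). Qed.

Lemma holomorphic_swap f : holomorphic_germ f -> holomorphic_germ (f \o @swap R).
Proof.
move=> /holomorphic_germP hf; apply/holomorphic_germP.
apply: filterS (near0_swap hf) => p [a /taylor_swap ta].
by exists (fun i j => a j i); move: ta; rewrite /swap/= -surjective_pairing.
Qed.

Lemma germ_eq_swap f g : germ_eq f g -> germ_eq (f \o @swap R) (g \o @swap R).
Proof. exact: (near0_swap (P := fun q => f q = g q)). Qed.

Lemma holomorphic_snd : holomorphic_germ (@snd R[i] R[i]).
Proof. exact: (holomorphic_swap holomorphic_fst). Qed.

(** The two difference quotients are the same function of the increment. *)
Lemma dy_swap f : dy f = dx (f \o @swap R) \o @swap R.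
Proof.
apply/funext => -[x y].
have E : (fun h : R[i] => h^-1 *: ((f \o shift ((x, y) : C2 R)) (h *: ((0, 1) : C2 R)) -
    f (x, y))) = (fun h => h^-1 *: (((f \o @swap R) \o shift ((y, x) : C2 R))
    (h *: ((1, 0) : C2 R)) - (f \o @swap R) (y, x))).
  by apply/funext => h; congr (_ *: (f _ - _)).
by rewrite /dy /derive E.
Qed.

Lemma holomorphic_dx f : holomorphic_germ f -> holomorphic_germ (dx f).
Proof.
move=> /holomorphic_germP hf; apply/holomorphic_germP.
by apply: filterS hf => p [a /taylor_dx[ta _]]; eexists; exact: ta.
Qed.

Lemma holomorphic_dy f : holomorphic_germ f -> holomorphic_germ (dy f).
Proof.
by move=> hf; rewrite dy_swap; apply/holomorphic_swap/holomorphic_dx/holomorphic_swap.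
Qed.

Lemma germ_eq_dx f g : germ_eq f g -> germ_eq (dx f) (dx g).
Proof. exact: near_dx_eq. Qed.

Lemma germ_eq_dy f g : germ_eq f g -> germ_eq (dy f) (dy g).
Proof.
by move=> fg; rewrite !dy_swap; apply/germ_eq_swap/germ_eq_dx/germ_eq_swap.
Qed.

Lemma holomorphic_derivable f : holomorphic_germ f ->
  \forall p \near (0 : C2 R), derivable f p (1, 0).
Proof.
move=> /holomorphic_germP; apply: filterS => p [a /taylor_dx[_ /nbhs_singleton]].
by rewrite addr0.
Qed.

Lemma germ_dxD f g : holomorphic_germ f -> holomorphic_germ g ->
  germ_eq (dx (f + g)) (dx f + dx g).
Proof.
move=> /holomorphic_derivable hf /holomorphic_derivable hg.
by apply: filterS2 hf hg => q fq gq; rewrite /dx (deriveD fq gq).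
Qed.

Lemma germ_dxM f g : holomorphic_germ f -> holomorphic_germ g ->
  germ_eq (dx (f * g)) (dx f * g + f * dx g).
Proof.
move=> /holomorphic_derivable hf /holomorphic_derivable hg.
apply: filterS2 hf hg => q fq gq; rewrite /dx (deriveM fq gq).
by rewrite addrC; congr (_ + _); exact: mulrC.
Qed.

Lemma germ_dyD f g : holomorphic_germ f -> holomorphic_germ g ->
  germ_eq (dy (f + g)) (dy f + dy g).
Proof.
move=> hf hg; rewrite !dy_swap.
exact: germ_eq_swap (germ_dxD (holomorphic_swap hf) (holomorphic_swap hg)).
Qed.

Lemma germ_dyM f g : holomorphic_germ f -> holomorphic_germ g ->
  germ_eq (dy (f * g)) (dy f * g + f * dy g).
Proof.
move=> hf hg; rewrite !dy_swap.
have := germ_eq_swap (germ_dxM (holomorphic_swap hf) (holomorphic_swap hg)).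
by apply: filterS => -[x y] h; exact: h.
Qed.

Lemma taylor0_germ0 f a : taylor f 0 a -> (forall i j, a i j = 0) -> germ_eq f 0.
Proof.
move=> [_ fa] a0; apply: filterS fa => z; rewrite add0r.
have -> : square_sum (power_series_term a z) = (fun=> 0).
  apply/funext => n; rewrite /square_sum big1// => i _; rewrite big1// => j _.
  by rewrite /power_series_term a0 !mul0r.
move=> s0; have c0 : (fun _ : nat => (0 : R[i])) @ \oo --> (0 : R[i]) by exact: cvg_cst.
exact: (cvg_unique _ s0 c0).
Qed.

(** Provides the leading coefficient for the lexicographic order on exponents. *)
Lemma lex_min_coef (a : nat -> nat -> R[i]) : ~ (forall i j, a i j = 0) ->
  exists i j, [/\ a i j != 0, forall k l, (k < i)%N -> a k l = 0 &
    forall l, (l < j)%N -> a i l = 0].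
Proof.
move=> a0.
have ex1 : exists i, `[< exists j, a i j != 0 >].
  apply: contrapT => h; apply: a0 => i j; apply/eqP/negPn/negP => aij.
  by apply: h; exists i; apply/asboolP; exists j.
have ex2 : exists j, a (ex_minn ex1) j != 0.
  by case: ex_minnP => i /asboolP.
exists (ex_minn ex1), (ex_minn ex2); split.
- by case: (ex_minnP ex2).
- case: ex_minnP => i _ imin k l ki; apply/eqP/negPn/negP => akl.
  have : (i <= k)%N by apply: imin; apply/asboolP; exists l.
  by rewrite leqNgt ki.
- case: (ex_minnP ex2) => j _ jmin l lj; apply/eqP/negPn/negP => al.
  by have := jmin _ al; rewrite leqNgt lj.
Qed.

(** Lexicographic leading terms multiply: at the sum of the two leading exponents every other
    summand of the Cauchy product contains a coefficient below a leading one, so the product has a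
    nonzero coefficient there. *)
Lemma germ_mul_eq0 f g : holomorphic_germ f -> holomorphic_germ g ->
  germ_eq (f * g) 0 -> germ_eq f 0 \/ germ_eq g 0.
Proof.
move=> /holomorphic_taylor0[a ta] /holomorphic_taylor0[b tb] fg0.
have ab0 := taylor_eq0 (taylorM ta tb) fg0.
have [a0|/lex_min_coef[i [j [aij ai aj]]]] := pselect (forall i j, a i j = 0).
  by left; exact: taylor0_germ0 a0.
have [b0|/lex_min_coef[k [l [bkl bk bl]]]] := pselect (forall i j, b i j = 0).
  by right; exact: taylor0_germ0 b0.
have ik : (i < (i + k).+1)%N by rewrite ltnS leq_addr.
have jl : (j < (j + l).+1)%N by rewrite ltnS leq_addr.
exfalso; have := ab0 (i + k)%N (j + l)%N; rewrite /Cauchy_product.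
rewrite (bigD1 (Ordinal ik))//= [X in _ + X]big1 ?addr0.
  rewrite (bigD1 (Ordinal jl))//= [X in _ + X]big1 ?addr0.
    by rewrite !addKn => /eqP; rewrite mulf_eq0 (negbTE aij) (negbTE bkl).
  move=> m mj; rewrite addKn; have [ltmj|lejm] := ltnP m j; first by rewrite aj ?mul0r.
  have ltjm : (j < m)%N.
    by rewrite ltn_neqAle lejm andbT; apply: contra mj => /eqP h; apply/eqP/val_inj.
  rewrite bl ?mulr0// -(ltn_add2r m) subnK; last by rewrite -ltnS ltn_ord.
  by rewrite [ltnRHS]addnC ltn_add2r.
move=> m mi; apply: big1 => n _; have [ltmi|leim] := ltnP m i.
  by rewrite ai ?mul0r.
have ltim : (i < m)%N.
  by rewrite ltn_neqAle leim andbT; apply: contra mi => /eqP h; apply/eqP/val_inj.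
rewrite bk ?mulr0// -(ltn_add2r m) subnK; last by rewrite -ltnS ltn_ord.
by rewrite [ltnRHS]addnC ltn_add2r.
Qed.

Lemma germ_mulfI f u v : holomorphic_germ f -> holomorphic_germ u ->
  holomorphic_germ v -> ~ germ_eq f 0 -> germ_eq (f * u) (f * v) -> germ_eq u v.
Proof.
move=> hf hu hv f0 fuv.
have : germ_eq (f * (u - v)) 0.
  by apply: filterS fuv => q; rewrite !fctE mulrBr => ->; rewrite subrr.
case/(germ_mul_eq0 hf (holomorphicB hu hv)) => [/f0[]|].
by apply: filterS => q; rewrite !fctE => /eqP; rewrite subr_eq0 => /eqP.
Qed.

Lemma fst_germ_neq0 : ~ germ_eq (@fst R[i] R[i]) 0.
Proof.
move=> /near0_coordP[e e0 h]; have := h (e, 0).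
rewrite /= normr0 gtr0_norm// lexx (ltW e0) => /(_ isT isT) e00.
by move: e0; rewrite [e]e00 ltxx.
Qed.

Lemma snd_germ_neq0 : ~ germ_eq (@snd R[i] R[i]) 0.
Proof. by move=> /germ_eq_swap; exact: fst_germ_neq0. Qed.

Lemma germX_neq0 f n : holomorphic_germ f -> ~ germ_eq f 0 ->
  ~ germ_eq (f ^+ n) 0.
Proof.
move=> hf f0; elim: n => [|n IH]; last first.
  by rewrite exprS => /(germ_mul_eq0 hf (holomorphicX n hf)) [].
by move=> /nbhs_singleton/eqP; rewrite expr0 oner_eq0.
Qed.

Lemma germ_div_fst w : holomorphic_germ w ->
  (\forall q \near (0 : C2 R), q.1 = 0 -> w q = 0) ->
  exists2 u, holomorphic_germ u & germ_eq w (@fst R[i] R[i] * u).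
Proof.
move=> /holomorphic_germP hw w0.
exists (fun q => if q.1 == 0 then dx w q else q.1^-1 * w q).
  (* Division is carried out at each base point [p] near 0, so the vanishing on the line is needed
     in a neighbourhood of every such [p]. *)
  apply/holomorphic_germP; have /near_join w00 := w0.
  by apply: filterS2 hw w00 => p [a ta]; exact: ex_taylor_div_fst ta.
apply: filterS w0 => q wq; rewrite -[RHS]/(q.1 * _).
case: eqVneq => [q0|q0]; first by rewrite q0 mul0r wq.
by rewrite mulrA mulfV// mul1r.
Qed.

Lemma germ_fst0 w : holomorphic_germ w -> holomorphic_germ (fun q => w (0, q.2)).
Proof.
move=> /holomorphic_germP hw; apply/holomorphic_germP.
apply: filterS (near_fst0 hw) => p [a /taylor_fst0 ta].
by eexists; exact: ta.
Qed.

(** On the line [X = 0] the equation becomes $y^m w(0,y) = 0$. The germs form a domain, so $w(0,y)$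
    vanishes and [X] divides [w]. *)
Lemma germ_snd_fst_coprime1 w u m : holomorphic_germ w -> holomorphic_germ u ->
  germ_eq ((@snd R[i] R[i]) ^+ m * w) (@fst R[i] R[i] * u) ->
  exists2 u', holomorphic_germ u' & germ_eq w (@fst R[i] R[i] * u').
Proof.
move=> hw hu wu; apply: (germ_div_fst hw).
have hw0 := germ_fst0 hw.
have : germ_eq ((@snd R[i] R[i]) ^+ m * (fun q => w (0, q.2))) 0.
  apply: filterS (near_fst0 wu) => q wuq.
  have : (snd ^+ m) (0, q.2) * w (0, q.2) = 0 * u (0, q.2) := wuq.
  rewrite mul0r fct_exprE/= => h.
  by rewrite -[LHS]/((snd ^+ m) q * w (0, q.2)) fct_exprE.
case/(germ_mul_eq0 (holomorphicX m holomorphic_snd) hw0).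
  by move=> /(germX_neq0 holomorphic_snd snd_germ_neq0).
by apply: filterS => -[x y] /= h x0; rewrite x0.
Qed.

(** Induction on [k]: extract one factor [X] from [w], cancel it on both sides, and continue with
    the quotient. *)
Lemma germ_snd_fst_coprime w u m k : holomorphic_germ w -> holomorphic_germ u ->
  germ_eq ((@snd R[i] R[i]) ^+ m * w) ((@fst R[i] R[i]) ^+ k * u) ->
  exists2 u', holomorphic_germ u' & germ_eq w ((@fst R[i] R[i]) ^+ k * u').
Proof.
elim: k w u => [|k IH] w u hw hu wu.
  by exists w; [exact: hw|rewrite expr0 mul1r; exact: germ_eq_refl].
have hk := holomorphicX k holomorphic_fst.
have hm := holomorphicX m holomorphic_snd.
have wu1 : germ_eq (snd ^+ m * w) (fst * (fst ^+ k * u)) by rewrite mulrA -exprS.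
have [w1 hw1 ww1] := germ_snd_fst_coprime1 hw (holomorphicM hk hu) wu1.
have /(germ_mulfI holomorphic_fst (holomorphicM hm hw1) (holomorphicM hk hu) fst_germ_neq0)
    : germ_eq (fst * (snd ^+ m * w1)) (fst * (fst ^+ k * u)).
  apply: germ_eq_trans wu1; apply: filterS ww1 => q; rewrite !fctE => ->.
  by rewrite mulrCA.
move=> /(IH _ _ hw1 hu)[u' hu' w1u']; exists u'; first exact: hu'.
apply: germ_eq_trans ww1 _; rewrite exprS -mulrA.
exact: germ_eqM (germ_eq_refl _) w1u'.
Qed.

Lemma holomorphic_inv_fst (c : R[i]) : c != 0 ->
  holomorphic_germ (fun q => (q.1 - c)^-1).
Proof.
move=> c0; apply/holomorphic_germP.
have c2 : 0 < `|c| / 2 by rewrite divr_gt0// normr_gt0.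
apply: filterS (near0_coord_le c2) => p [p1 _]; apply: ex_taylor_inv_fst.
apply/eqP => pc; move: p1; rewrite pc ler_pdivlMr// ger_pMr ?normr_gt0//.
by rewrite lt_geF// ltr1n.
Qed.

End Germs.

(** * Ideals with two generators and intersection numbers *)

Section Ideals.
Variable R : realType.
Implicit Types (f g h u v w a b : C2 R -> R[i]).
Notation hol := (@holomorphic_germ R).

Lemma ideal_germ_eq f g u v : germ_eq u v -> germ_ideal2 f g u -> germ_ideal2 f g v.
Proof.
move=> uv [a [b [ha hb uab]]]; exists a, b; split; [exact: ha|exact: hb|].
exact: germ_eq_trans (germ_eq_sym uv) uab.
Qed.

Lemma ideal_comb f g a b : hol a -> hol b -> germ_ideal2 f g (a * f + b * g).
Proof. by move=> ha hb; exists a, b; split; [exact: ha|exact: hb|exact: germ_eq_refl]. Qed.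

Lemma idealD f g u v : germ_ideal2 f g u -> germ_ideal2 f g v ->
  germ_ideal2 f g (u + v).
Proof.
move=> [a [b [ha hb uab]]] [c [d [hc hd vcd]]].
exists (a + c), (b + d); split; [exact: holomorphicD|exact: holomorphicD|].
by apply: filterS2 uab vcd => q; rewrite !fctE => -> ->; ring.
Qed.

Lemma idealM f g u c : hol c -> germ_ideal2 f g u -> germ_ideal2 f g (c * u).
Proof.
move=> hc [a [b [ha hb uab]]].
exists (c * a), (c * b); split; [exact: holomorphicM|exact: holomorphicM|].
by apply: filterS uab => q; rewrite !fctE => ->; ring.
Qed.

Lemma idealB f g u v : germ_ideal2 f g u -> germ_ideal2 f g v ->
  germ_ideal2 f g (u - v).
Proof.
move=> hu hv; have := idealD hu (idealM (holomorphic_cst (-1)) hv).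
by apply: ideal_germ_eq; apply: C2_nearW => q; rewrite !fctE mulN1r.
Qed.

Lemma ideal0 f g : germ_ideal2 f g 0.
Proof.
have := ideal_comb f g (holomorphic_cst 0) (holomorphic_cst 0).
by apply: ideal_germ_eq; apply: C2_nearW => q; rewrite !fctE !mul0r addr0.
Qed.

Lemma ideal_l f g u : hol u -> germ_ideal2 f g (u * f).
Proof.
move=> hu; have := ideal_comb f g hu (holomorphic_cst 0).
by apply: ideal_germ_eq; apply: C2_nearW => q; rewrite !fctE mul0r addr0.
Qed.

Lemma ideal_r f g u : hol u -> germ_ideal2 f g (u * g).
Proof.
move=> hu; have := ideal_comb f g (holomorphic_cst 0) hu.
by apply: ideal_germ_eq; apply: C2_nearW => q; rewrite !fctE mul0r add0r.
Qed.

Lemma ideal_sum f g (n : nat) (F : 'I_n -> C2 R -> R[i]) :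
  (forall i, germ_ideal2 f g (F i)) ->
  germ_ideal2 f g (fun z => \sum_(i < n) F i z).
Proof.
move=> hF; have h : germ_ideal2 f g (\sum_(i < n) F i).
  apply: (big_ind (germ_ideal2 f g)); first exact: ideal0.
    by move=> u v; exact: idealD.
  by move=> i _; exact: hF.
by apply: ideal_germ_eq h; apply: C2_nearW => q; rewrite fct_sumE.
Qed.

Lemma ideal_sub f g f' g' u : germ_ideal2 f g f' -> germ_ideal2 f g g' ->
  germ_ideal2 f' g' u -> germ_ideal2 f g u.
Proof.
move=> If Ig [a [b [ha hb uab]]]; apply: ideal_germ_eq (germ_eq_sym uab) _.
by apply: idealD; exact: idealM.
Qed.

Lemma ideal_germ_eq_gen f g f' g' u : germ_eq f f' -> germ_eq g g' ->
  germ_ideal2 f g u -> germ_ideal2 f' g' u.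
Proof.
move=> ff gg [a [b [ha hb uab]]]; exists a, b; split; [exact: ha|exact: hb|].
apply: germ_eq_trans uab _.
by apply: germ_eqD; apply: germ_eqM => //; exact: germ_eq_refl.
Qed.

Lemma ideal_swap f g u : germ_ideal2 f g u ->
  germ_ideal2 (f \o @swap R) (g \o @swap R) (u \o @swap R).
Proof.
move=> [a [b [ha hb uab]]]; exists (a \o @swap R), (b \o @swap R).
split; [exact: holomorphic_swap|exact: holomorphic_swap|].
exact: germ_eq_swap uab.
Qed.

(** This says that the quotient has dimension at least [n]. It is downward closed in [n], so exact
    dimension [n] is handled as success at [n] together with failure at [n.+1]. *)
Definition has_free f g (n : nat) := exists v : 'I_n -> C2 R -> R[i],
  (forall i, hol (v i)) /\ free_mod_ideal2 f g v.

Lemma has_free0 f g : has_free f g 0.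
Proof. by exists (fun=> 0); split=> [[]|c _ []]. Qed.

Lemma has_free_le f g m n : (m <= n)%N -> has_free f g n -> has_free f g m.
Proof.
move=> mn [v [hv fv]]; exists (fun i => v (widen_ord mn i)).
split=> [i|c cI i]; first exact: hv.
(* The coefficients are extended by 0 to the longer family. *)
pose c' (j : 'I_n) : R[i] := if insub (j : nat) is Some k then c k else 0.
have c'E k : c' (widen_ord mn k) = c k.
  by rewrite /c' insubT//= => kn; congr c; exact: val_inj.
rewrite -c'E; apply: fv; move: cI; apply: ideal_germ_eq; apply: C2_nearW => q.
rewrite (bigID (fun j : 'I_n => (j < m)%N))/= [X in _ = _ + X]big1 ?addr0; last first.
  by move=> j jm; rewrite /c' insubF ?mul0r//; exact: negbTE.
rewrite (big_ord_narrow mn); apply: eq_bigr => k _.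
by rewrite c'E.
Qed.

Lemma intersection_number_ge f g n : has_free f g n ->
  (n%:R%:E <= intersection_number f g)%E.
Proof. by move=> hn; apply: ereal_sup_ubound; exists n. Qed.

Lemma intersection_number_ge0 f g : (0 <= intersection_number f g)%E.
Proof. exact: intersection_number_ge (has_free0 f g). Qed.

Lemma intersection_number_eq f g n : has_free f g n -> ~ has_free f g n.+1 ->
  intersection_number f g = n%:R%:E.
Proof.
move=> hn hn1; apply/eqP; rewrite eq_le intersection_number_ge// andbT.
apply: ge_ereal_sup => _ [k hk <-]; rewrite lee_fin ler_nat leqNgt.
by apply/negP => nk; apply: hn1; exact: has_free_le hk.
Qed.

Lemma intersection_number_fin f g : intersection_number f g != +oo%E ->
  exists n, has_free f g n /\ ~ has_free f g n.+1.
Proof.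
move=> moo.
have [N hN] : exists N, ~ has_free f g N.
  apply: contrapT => /forallNP h; move/negP: moo; apply; apply/eqP/eqyP => r r0.
  have [n rn] : exists n, r <= n%:R.
    by exists (Num.truncn r).+1; exact: ltW (truncnS_gt r).
  apply: (@le_trans _ _ n%:R%:E); first by rewrite lee_fin.
  by apply: intersection_number_ge; apply: contrapT; exact: h.
elim: N hN => [h|N IH hN]; first by case: h; exact: has_free0.
by have [h|] := pselect (has_free f g N); [exists N|].
Qed.

Lemma le_intersection_number f g f' g' :
  (forall u, germ_ideal2 f g u -> germ_ideal2 f' g' u) ->
  (intersection_number f' g' <= intersection_number f g)%E.
Proof.
move=> sub; apply: ge_ereal_sup => _ [k [v [hv fv]] <-].
by apply: intersection_number_ge; exists v; split=> // c /sub; exact: fv.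
Qed.

Lemma eq_intersection_number f g f' g' :
  (forall u, germ_ideal2 f g u -> germ_ideal2 f' g' u) ->
  (forall u, germ_ideal2 f' g' u -> germ_ideal2 f g u) ->
  intersection_number f g = intersection_number f' g'.
Proof. by move=> h1 h2; apply/eqP; rewrite eq_le !le_intersection_number. Qed.

Lemma intersection_numberC f g : intersection_number f g = intersection_number g f.
Proof.
by apply: eq_intersection_number => u [a [b [ha hb uab]]]; exists b, a;
  (split; [exact: hb|exact: ha|rewrite addrC; exact: uab]).
Qed.

Lemma intersection_number_germ_eq f g f' g' : germ_eq f f' -> germ_eq g g' ->
  intersection_number f g = intersection_number f' g'.
Proof.
move=> ff gg; apply: eq_intersection_number => u; apply: ideal_germ_eq_gen => //;
  exact: germ_eq_sym.
Qed.

(** Putting [u] in front of [v] gives a family too long to be free. Its nontrivial relation has a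
    nonzero coefficient at [u], since [v] itself is free; divide by it. *)
Lemma maximal_free_span f g n (v : 'I_n -> C2 R -> R[i]) u :
  (forall i, hol (v i)) -> free_mod_ideal2 f g v -> ~ has_free f g n.+1 -> hol u ->
  exists d : 'I_n -> R[i], germ_ideal2 f g (fun z => u z - \sum_(i < n) d i * v i z).
Proof.
move=> hv fv nf hu.
pose v' (i : 'I_n.+1) := if unlift ord0 i is Some j then v j else u.
have v'0 : v' ord0 = u by rewrite /v' unlift_none.
have v'S j : v' (lift ord0 j) = v j by rewrite /v' liftK.
have : ~ free_mod_ideal2 f g v'.
  move=> fv'; apply: nf; exists v'; split=> [i|]; last exact: fv'.
  by rewrite /v'; case: unliftP => [j _|_]; [exact: hv|exact: hu].
move=> /existsNP[c] /not_implyP[cI c0].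
have cE : (fun z => \sum_(i < n.+1) c i * v' i z) =
    (fun z => c ord0 * u z + \sum_(i < n) c (lift ord0 i) * v i z).
  apply/funext => z; rewrite big_ord_recl v'0; congr (_ + _).
  by apply: eq_bigr => i _; rewrite v'S.
rewrite cE in cI.
have c00 : c ord0 != 0.
  apply/eqP => c00; apply: c0 => i.
  case: (unliftP ord0 i) => [j ->|->] //.
  apply: (fv (fun j => c (lift ord0 j))); move: cI; apply: ideal_germ_eq.
  by apply: C2_nearW => z; rewrite c00 mul0r add0r.
exists (fun i => - (c ord0)^-1 * c (lift ord0 i)).
have := idealM (holomorphic_cst (c ord0)^-1) cI; apply: ideal_germ_eq.
apply: C2_nearW => z; rewrite !fctE mulrDr mulKf//; congr (_ + _).
rewrite mulr_sumr -sumrN; apply: eq_bigr => i _; ring.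
Qed.

Lemma free_span_le f g n k (e : 'I_n -> C2 R -> R[i]) (u : 'I_k -> C2 R -> R[i]) :
  free_mod_ideal2 f g u ->
  (forall j, exists d : 'I_n -> R[i],
     germ_ideal2 f g (fun z => u j z - \sum_(i < n) d i * e i z)) ->
  (k <= n)%N.
Proof.
move=> fu /choice[d dI]; rewrite leqNgt; apply/negP => nk.
pose D : 'M[R[i]]_(k, n) := \matrix_(j, i) d j i.
(* With more vectors than spanning elements, the rows of coordinates are dependent; a row in the
   kernel gives a nontrivial relation among the [u j] modulo the ideal. *)
have : kermx D != 0.
  by rewrite -mxrank_eq0 mxrank_ker -lt0n subn_gt0 (leq_ltn_trans (rank_leq_col D)).
case/rowV0Pn => c /sub_kermxP cD /negP; apply; apply/eqP/rowP => j; rewrite mxE.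
apply: (fu (fun j => c 0 j)).
have hI : germ_ideal2 f g (fun z => \sum_(j < k)
    ((fun=> c 0 j) * (fun z => u j z - \sum_(i < n) d j i * e i z)) z).
  by apply: ideal_sum => j'; apply: idealM (holomorphic_cst _) _.
apply: ideal_germ_eq hI; apply: C2_nearW => z.
under eq_bigr => j' _ do rewrite !fctE mulrBr.
rewrite sumrB.
have -> : \sum_(j < k) c 0 j * (\sum_(i < n) d j i * e i z) = 0.
  under eq_bigr => j' _ do rewrite mulr_sumr.
  rewrite exchange_big/= big1// => i _.
  have /rowP/(_ i) := cD; rewrite !mxE => cDi.
  transitivity ((\sum_j c 0 j * D j i) * e i z); last by rewrite cDi mul0r.
  rewrite mulr_suml; apply: eq_bigr => j' _.
  by rewrite mxE mulrA.
by rewrite subr0.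
Qed.

(** This is the exact sequence $0 \to O/(f,g) \to O/(f,gh) \to O/(f,h) \to 0$ whose first map is
    multiplication by $h$. The divisibility hypothesis makes that map injective, and [e] is the
    resulting basis of the middle term. *)
Lemma intersection_number_additive_fin f g h m n :
  hol f -> hol g -> hol h ->
  (forall u v, hol u -> hol v -> germ_eq (h * u) (f * v) ->
     exists2 w, hol w & germ_eq u (f * w)) ->
  has_free f g m -> ~ has_free f g m.+1 ->
  has_free f h n -> ~ has_free f h n.+1 ->
  intersection_number f (g * h) = (m + n)%:R%:E.
Proof.
move=> hf hg hh nzd [v [hv fv]] nv [w [hw fw]] nw.
pose e (k : 'I_(m + n)) : C2 R -> R[i] :=
  match fintype.split k with inl i => h * v i | inr j => w j end.
have eE (c : 'I_(m + n) -> R[i]) z : \sum_k c k * e k z =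
    \sum_(i < m) c (lshift n i) * (h z * v i z) +
    \sum_(j < n) c (rshift m j) * w j z.
  rewrite big_split_ord; congr (_ + _); apply: eq_bigr => i _; rewrite /e.
    by rewrite (unsplitK (inl i)).
  by rewrite (unsplitK (inr i)).
have he k : hol (e k).
  by rewrite /e; case: fintype.split => i; [exact: holomorphicM hh (hv i)|exact: hw].
apply: intersection_number_eq.
  exists e; split; first exact: he.
  move=> c; have -> : (fun z => \sum_k c k * e k z) =
      h * (fun z => \sum_(i < m) c (lshift n i) * v i z) +
      (fun z => \sum_(j < n) c (rshift m j) * w j z).
    apply/funext => z; rewrite eE !fctE mulr_sumr; congr (_ + _).
    by apply: eq_bigr => i _; ring.
  set A := (fun z => \sum_(i < m) c (lshift n i) * v i z).
  set B := (fun z => \sum_(j < n) c (rshift m j) * w j z).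
  move=> cI.
  have hA : hol A.
    have := @holomorphic_sum R 'I_m (index_enum _) xpredT
      (fun i => (fun=> c (lshift n i)) * v i)
      (fun i => holomorphicM (holomorphic_cst _) (hv i)).
    by congr holomorphic_germ; apply/funext => z; rewrite fct_sumE.
  (* Modulo [<f, h>] the part [h * A] disappears, and freeness of [w] applies. *)
  have cr : forall j, c (rshift m j) = 0.
    apply: (fw (fun j => c (rshift m j))).
    have cI2 : germ_ideal2 f h (h * A + B).
      apply: ideal_sub cI.
        have := ideal_l f h (holomorphic_cst 1).
        by apply: ideal_germ_eq; apply: C2_nearW => q; rewrite !fctE mul1r.
      exact: ideal_r.
    have := idealB cI2 (ideal_r f h hA); apply: ideal_germ_eq.
    apply: C2_nearW => q; rewrite -[LHS]/(h q * A q + B q - A q * h q).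
    by rewrite mulrC addrAC subrr add0r.
  have B0 : B = 0.
    by apply/funext => z; rewrite /B big1// => j _; rewrite cr mul0r.
  have cl : forall i, c (lshift n i) = 0.
    apply: (fv (fun i => c (lshift n i))).
    move: cI => [a [b [ha hb]]]; rewrite B0 addr0 => AE.
    (* What remains is [h * A = a * f + b * (g * h)], that is, [h * (A - b * g) = f * a]; cancelling
       [h] modulo [f] puts [A] in [<f, g>]. *)
    have [s hs sE] : exists2 s, hol s & germ_eq (A - b * g) (f * s).
      apply: (nzd _ a (holomorphicB hA (holomorphicM hb hg)) ha).
      by apply: filterS AE => q; rewrite !fctE mulrBr => ->; ring.
    exists s, b; split; [exact: hs|exact: hb|].
    by apply: filterS sE => q; rewrite !fctE => sq; rewrite mulrC -sq subrK.
  move=> k; rewrite -(splitK k); case: (fintype.split k) => i /=.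
    exact: cl.
  exact: cr.
move=> [u [hu fu]].
suff : ((m + n).+1 <= m + n)%N by rewrite ltnn.
apply: (free_span_le (e := e) fu) => k.
(* Spanning in two stages: reduce [u k] modulo [<f, h>], then reduce the coefficient [b] of [h]
   modulo [<f, g>]. *)
have [d [a [b [ha hb dE]]]] := maximal_free_span hw fw nw (hu k).
have [c [a' [b' [ha' hb' cE]]]] := maximal_free_span hv fv nv hb.
exists (fun k => match fintype.split k with inl i => c i | inr j => d j end).
exists (a + h * a'), b'; split; last first.
- apply: filterS2 dE cE => z; rewrite !fctE => dz cz.
  rewrite eE.
  have -> : \sum_(i < m) match fintype.split (lshift n i) with inl i => c i | inr j => d j end
      * (h z * v i z) = h z * \sum_(i < m) c i * v i z.
    rewrite mulr_sumr; apply: eq_bigr => i _.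
    by rewrite (unsplitK (inl i)); ring.
  have -> : \sum_(j < n) match fintype.split (rshift m j) with inl i => c i | inr j => d j end
      * w j z = \sum_(j < n) d j * w j z.
    by apply: eq_bigr => j _; rewrite (unsplitK (inr j)).
  have bE : \sum_(i < m) c i * v i z = b z - (a' z * f z + b' z * g z).
    by rewrite -cz; ring.
  have uE : u k z = a z * f z + b z * h z + \sum_(j < n) d j * w j z.
    by rewrite -dz; ring.
  by rewrite bE uE; ring.
- exact: hb'.
- by apply: holomorphicD ha (holomorphicM hh ha').
Qed.

End Ideals.

(** * Additivity of the intersection number in the second argument *)

Section Additivity.
Variable R : realType.
Implicit Types (f g h u v w a b : C2 R -> R[i]).
Notation hol := (@holomorphic_germ R).
Notation X := (@fst R[i] R[i]).
Notation Y := (@snd R[i] R[i]).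

Lemma swapK (q : C2 R) : swap (swap q) = q. Proof. by case: q. Qed.

Lemma holomorphic_mul_inv_fst (c : R[i]) : c != 0 ->
  germ_eq ((fun q : C2 R => (q.1 - c)^-1) * (fun q => q.1 - c)) 1.
Proof.
move=> c0.
have c2 : 0 < `|c| / 2 by rewrite divr_gt0// normr_gt0.
apply: filterS (near0_coord_le c2) => p [p1 _].
rewrite -[LHS]/((p.1 - c)^-1 * (p.1 - c)) mulVf// subr_eq0.
apply/eqP => pc; move: p1; rewrite pc ler_pdivlMr// ger_pMr ?normr_gt0//.
by rewrite lt_geF// ltr1n.
Qed.

(** A root 0 contributes a factor [X], which is absorbed into [u]; a nonzero root gives a unit,
    which is inverted. This is why [u] is general in the induction. *)
Lemma ideal_linear_factors f g (r : seq R[i]) u : hol u ->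
  germ_ideal2 f g (fun q => (\prod_(c <- r) (q.1 - c)) * u q) ->
  exists k, germ_ideal2 f g (X ^+ k * u).
Proof.
elim: r u => [|c r IH] u hu.
  move=> hI; exists 0%N; move: hI; apply: ideal_germ_eq; apply: C2_nearW => q.
  by rewrite big_nil expr0 !mul1r.
have [->|c0] := eqVneq c 0.
  move=> hI; have [|k hk] := IH (X * u) (holomorphicM (holomorphic_fst R) hu).
    move: hI; apply: ideal_germ_eq; apply: C2_nearW => q.
    by rewrite big_cons !fctE subr0; ring.
  by exists k.+1; rewrite exprSr -mulrA.
move=> /(idealM (holomorphic_inv_fst c0)) hI; apply: (IH u hu).
move: hI; apply: ideal_germ_eq; apply: filterS (holomorphic_mul_inv_fst c0) => q.
rewrite !fctE big_cons => qc.
by rewrite mulrA mulrA qc -[X in X * _ * _]/1 mul1r.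
Qed.

Lemma fst_expr_in_ideal f g n : ~ has_free f g n ->
  exists k, germ_ideal2 f g (X ^+ k).
Proof.
move=> nf.
have hX i := holomorphicX i (holomorphic_fst R).
have : ~ free_mod_ideal2 f g (fun i : 'I_n => X ^+ i).
  by move=> fv; apply: nf; exists (fun i => X ^+ i); split=> [i|]; [exact: hX|exact: fv].
move=> /existsNP[c] /not_implyP[cI c0].
(* The relation among [1, X, ..., X^(n-1)] modulo the ideal, read as a nonzero polynomial evaluated
   at the first coordinate. *)
pose p : {poly R[i]} := \poly_(i < n) (if insub i is Some j then c j else 0).
have pE i : p`_i = if insub i is Some j then c j else 0.
  by rewrite coef_poly; case: ltnP => // ni; rewrite insubF// ltnNge ni.
have p0 : p != 0.
  apply/eqP => p0; apply: c0 => i; have := pE i; rewrite p0 coef0.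
  by rewrite insubT//= => ii; rewrite {1}[RHS](_ : _ = c i)//; congr c; exact: val_inj.
have [r pr] := closed_field_poly_normal p.
have [k] : exists k, germ_ideal2 f g (X ^+ k * 1).
  apply: (@ideal_linear_factors f g r 1 (holomorphic_cst 1)).
  have := idealM (holomorphic_cst (lead_coef p)^-1) cI; apply: ideal_germ_eq.
  apply: C2_nearW => q; rewrite !fctE -[1 q]/1 mulr1.
  have -> : \sum_(i < n) c i * (X ^+ i) q = p.[q.1].
    rewrite /p horner_poly; apply: eq_bigr => i _.
    by rewrite fct_exprE/= insubT//= => ii; congr (c _ * _); exact: val_inj.
  rewrite [p in p.[_]]pr hornerZ mulKf ?lead_coef_eq0//.
  by rewrite horner_prod; apply: eq_bigr => z _; rewrite hornerXsubC.
by rewrite mulr1 => hk; exists k.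
Qed.

Lemma has_free_swap f g n : has_free (f \o @swap R) (g \o @swap R) n -> has_free f g n.
Proof.
move=> [v [hv fv]]; exists (fun i => v i \o @swap R); split=> [i|c cI].
  exact: holomorphic_swap (hv i).
apply: fv; have := ideal_swap cI; apply: ideal_germ_eq.
by apply: C2_nearW => q; apply: eq_bigr => i _; rewrite /= swapK.
Qed.

Lemma snd_expr_in_ideal f g n : ~ has_free f g n ->
  exists k, germ_ideal2 f g (Y ^+ k).
Proof.
move=> nf.
have [k /ideal_swap hk] := @fst_expr_in_ideal (f \o @swap R) (g \o @swap R) n
  (fun hs => nf (has_free_swap hs)).
exists k; have := @ideal_germ_eq_gen R _ _ f g _ _ _ hk.
have ss u : germ_eq ((u \o @swap R) \o @swap R) u by apply: C2_nearW => q /=; rewrite swapK.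
move=> /(_ (ss f) (ss g)); apply: ideal_germ_eq; apply: C2_nearW => q.
by rewrite /= !fct_exprE.
Qed.

(* Powers of both coordinates lie in [<f, h>], so [X^k u] and [Y^m u] are
   multiples of [f]; as [X^k] and [Y^m] are coprime, so is [u]. *)
Lemma coprime_mod f h n u v : hol f -> hol h -> ~ has_free f h n ->
  hol u -> hol v -> germ_eq (h * u) (f * v) ->
  exists2 w, hol w & germ_eq u (f * w).
Proof.
move=> hf hh nf hu hv huv.
have hX i := holomorphicX i (holomorphic_fst R).
have hY i := holomorphicX i (holomorphic_snd R).
have mult t : germ_ideal2 f h t -> exists2 w, hol w & germ_eq (t * u) (f * w).
  move=> [a [b [ha hb tE]]]; exists (a * u + b * v).
    exact: holomorphicD (holomorphicM ha hu) (holomorphicM hb hv).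
  apply: filterS2 tE huv => q; rewrite !fctE => -> hq.
  rewrite mulrDl [RHS]mulrDr; congr (_ + _); first by ring.
  by rewrite -mulrA hq; ring.
have [k /mult[w hw wE]] := fst_expr_in_ideal nf.
have [m /mult[w' hw' w'E]] := snd_expr_in_ideal nf.
have Xk0 := @germX_neq0 R X k (holomorphic_fst R) (@fst_germ_neq0 R).
(* Cancelling [f] below requires [f] nonzero. If [f] vanishes, then so does [X ^+ k * u], and hence
   [u]. *)
have [f0|f0] := pselect (germ_eq f 0).
  exists 0; first exact: (holomorphic_cst 0).
  have : germ_eq (X ^+ k * u) (X ^+ k * (f * 0)).
    by apply: filterS2 wE f0 => q; rewrite !fctE => -> ->; rewrite -[0 q]/0; ring.
  exact: (germ_mulfI (hX k) hu (holomorphicM hf (holomorphic_cst 0)) Xk0).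
have : germ_eq (f * (Y ^+ m * w)) (f * (X ^+ k * w')).
  apply: filterS2 wE w'E => q; rewrite !fctE => h1 h2.
  by rewrite mulrCA -h1 [RHS]mulrCA -h2; ring.
move=> /(germ_mulfI hf (holomorphicM (hY m) hw) (holomorphicM (hX k) hw') f0).
move=> /(germ_snd_fst_coprime hw hw')[s hs wsE]; exists s; first exact: hs.
have : germ_eq (X ^+ k * u) (X ^+ k * (f * s)).
  by apply: filterS2 wE wsE => q; rewrite !fctE => -> ->; ring.
exact: (germ_mulfI (hX k) hu (holomorphicM hf hs) Xk0).
Qed.

Lemma intersection_numberM f g h : hol f -> hol g -> hol h ->
  intersection_number f (g * h) =
  (intersection_number f g + intersection_number f h)%E.
Proof.
move=> hf hg hh.
have m0 := @intersection_number_ge0 R.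
have le_r a b : hol a -> (intersection_number f b <= intersection_number f (a * b)%R)%E.
  move=> ha; apply: le_intersection_number => u; apply: ideal_sub; last exact: ideal_r.
  by have := ideal_l f b (holomorphic_cst 1); apply: ideal_germ_eq;
    apply: C2_nearW => q; rewrite !fctE mul1r.
have [ginf|/intersection_number_fin[m [fm nm]]] := eqVneq (intersection_number f g) +oo%E.
  rewrite ginf addye; last by rewrite gt_eqF// (lt_le_trans _ (m0 _ _))// ltNyr.
  by apply/eqP; rewrite eq_le leey -ginf mulrC le_r.
have [hinf|/intersection_number_fin[n [fn nn]]] := eqVneq (intersection_number f h) +oo%E.
  rewrite hinf addey; last by rewrite gt_eqF// (lt_le_trans _ (m0 _ _))// ltNyr.
  by apply/eqP; rewrite eq_le leey -hinf le_r.
rewrite (intersection_number_eq fm nm) (intersection_number_eq fn nn) -EFinD -natrD.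
apply: (intersection_number_additive_fin hf hg hh _ fm nm fn nn) => u v hu hv.
exact: (coprime_mod hf hh nn hu hv).
Qed.

Lemma intersection_number1 f : intersection_number f 1 = 0%E.
Proof.
rewrite (intersection_number_eq (has_free0 f 1))// => -[v [hv fv]].
have vI : germ_ideal2 f 1 (fun z => \sum_(i < 1) 1 * v i z).
  have := ideal_r f 1 (hv ord0); apply: ideal_germ_eq.
  by apply: C2_nearW => q; rewrite big_ord_recl big_ord0 addr0 mul1r mulr1.
by have /eqP := fv (fun=> 1) vI ord0; rewrite oner_eq0.
Qed.

Lemma intersection_number_prod (I : Type) (r : seq I) (P : pred I)
    (F : I -> C2 R -> R[i]) f : hol f -> (forall i, hol (F i)) ->
  intersection_number f (\prod_(i <- r | P i) F i) =
  (\sum_(i <- r | P i) intersection_number f (F i))%E.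
Proof.
move=> hf hF.
have [] : hol (\prod_(i <- r | P i) F i) /\
  intersection_number f (\prod_(i <- r | P i) F i) =
  (\sum_(i <- r | P i) intersection_number f (F i))%E; last by [].
apply: (big_rec2 (fun u x => hol u /\ intersection_number f u = x)).
  by split; [exact: (holomorphic_cst 1)|exact: intersection_number1].
move=> i x u _ [hu <-]; split; first exact: holomorphicM (hF i) hu.
exact: (intersection_numberM hf (hF i) hu).
Qed.

Lemma intersection_numberX f g k : hol f -> hol g ->
  intersection_number f (g ^+ k) = (k%:R%:E * intersection_number f g)%E.
Proof.
(* For exponent 0 the convention [0 * +oo = 0] agrees with the intersection number with a unit. *)
move=> hf hg; elim: k => [|k IH]; first by rewrite mul0e; exact: intersection_number1.
rewrite exprS (intersection_numberM hf hg (holomorphicX k hg)) IH.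
rewrite -natr1 EFinD ge0_muleDl ?lee_fin// mul1e addeC.
by [].
Qed.

End Additivity.

(** * Polynomial identities behind the Leibniz congruences *)

(** With $\tau = (f_y,-f_x)$, the right-hand bracket is $\mathrm{Hess} f(\tau,\tau)$. Modulo $f$,
    the Hessian of $fg$ is $g\,\mathrm{Hess} f + df\,dg + dg\,df$, and $df(\tau) = 0$. The tangent
    vector scales by $g$, giving $g^2 \cdot g$. *)
Lemma inflection_leibniz_identity (A : comPzRingType)
    (fx fy fxx fxy fyy g gx gy : A) :
  (fy * g) ^+ 2 * (fxx * g + fx * gx + fx * gx) -
  2 * (fx * g) * (fy * g) * (fxy * g + fx * gy + fy * gx) +
  (fx * g) ^+ 2 * (fyy * g + fy * gy + fy * gy) =
  g ^+ 3 * (fy ^+ 2 * fxx - 2 * fx * fy * fxy + fx ^+ 2 * fyy).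
Proof. ring. Qed.

(** With $\tau = (f_y,-f_x)$ and $\nu = (f_x,f_y)$, the cubic is $-D^3f(\tau,\tau,\tau)$ and the
    factor beside $3\,i_f$ is $-\mathrm{Hess} f(\nu,\tau)$. Passing to $fg$ adds $3\,dg(\tau)\,i_f$
    to the third derivative and $|\nu|^2 dg(\tau)$ to the mixed Hessian, where $|\nu|^2 =
    f_x^2+f_y^2$. The two resulting terms $3 g^5 |\nu|^2 dg(\tau)\,i_f$ have opposite signs and
    cancel. *)
Lemma vertex_leibniz_identity (A : comPzRingType)
    (fx fy fxx fxy fyy fxxx fxxy fxyy fyyy g gx gy gxx gxy gyy : A) :
  ((fx * g) ^+ 2 + (fy * g) ^+ 2) *
  ((fx * g) ^+ 3 * (fyyy * g + fyy * gy + (fyy * gy + fy * gyy) +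
     (fyy * gy + fy * gyy + fy * gyy)) -
   3 * (fx * g) ^+ 2 * (fy * g) * (fxyy * g + fxy * gy + (fxy * gy + fx * gyy) +
     (fyy * gx + fy * gxy + fy * gxy)) +
   3 * (fx * g) * (fy * g) ^+ 2 * (fxxy * g + fxx * gy + (fxy * gx + fx * gxy) +
     (fxy * gx + fx * gxy + fy * gxx)) -
   (fy * g) ^+ 3 * (fxxx * g + fxx * gx + (fxx * gx + fx * gxx) +
     (fxx * gx + fx * gxx + fx * gxx))) -
  3 * (((fx * g) ^+ 2 - (fy * g) ^+ 2) * (fxy * g + fx * gy + fy * gx) -
    fx * g * (fy * g) * (fxx * g + fx * gx + fx * gx - (fyy * g + fy * gy + fy * gy))) *
  (g ^+ 3 * (fy ^+ 2 * fxx - 2 * fx * fy * fxy + fx ^+ 2 * fyy)) =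
  g ^+ 6 * ((fx ^+ 2 + fy ^+ 2) *
    (fx ^+ 3 * fyyy - 3 * fx ^+ 2 * fy * fxyy + 3 * fx * fy ^+ 2 * fxxy
      - fy ^+ 3 * fxxx)
  - 3 * ((fx ^+ 2 - fy ^+ 2) * fxy - fx * fy * (fxx - fyy)) *
    (fy ^+ 2 * fxx - 2 * fx * fy * fxy + fx ^+ 2 * fyy)).
Proof. ring. Qed.

(** * Congruences modulo a factor *)

Section Congruences.
Variable R : realType.
Implicit Types (f g u v w F : C2 R -> R[i]) (D : (C2 R -> R[i]) -> C2 R -> R[i]).
Notation hol := (@holomorphic_germ R).

(** Abstracting [dx] and [dy] proves each iterated Leibniz rule once for all mixed partials. *)
Definition germ_derivation D :=
  [/\ forall f, hol f -> hol (D f),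
      forall f g, germ_eq f g -> germ_eq (D f) (D g),
      forall f g, hol f -> hol g -> germ_eq (D (f + g)) (D f + D g) &
      forall f g, hol f -> hol g -> germ_eq (D (f * g)) (D f * g + f * D g)].

Lemma dx_derivation : germ_derivation (@dx R).
Proof.
split; [exact: holomorphic_dx|exact: germ_eq_dx|exact: germ_dxD|exact: germ_dxM].
Qed.

Lemma dy_derivation : germ_derivation (@dy R).
Proof.
split; [exact: holomorphic_dy|exact: germ_eq_dy|exact: germ_dyD|exact: germ_dyM].
Qed.

Lemma germ_leibniz D f g F : germ_derivation D -> hol f -> hol g ->
  germ_eq F (f * g) -> germ_eq (D F) (D f * g + f * D g).
Proof. by move=> [_ De _ DM] hf hg /De /germ_eq_trans; apply; exact: DM. Qed.

Lemma germ_leibniz2 D1 D2 f g F : germ_derivation D1 -> germ_derivation D2 ->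
  hol f -> hol g -> germ_eq F (f * g) ->
  germ_eq (D2 (D1 F)) (D2 (D1 f) * g + D1 f * D2 g + (D2 f * D1 g + f * D2 (D1 g))).
Proof.
move=> d1 d2 hf hg hF.
have [D1h _ _ _] := d1; have [D2h D2e D2D D2M] := d2.
have hf1 := D1h _ hf; have hg1 := D1h _ hg.
apply: germ_eq_trans (D2e _ _ (germ_leibniz d1 hf hg hF)) _.
apply: germ_eq_trans (D2D _ _ (holomorphicM hf1 hg) (holomorphicM hf hg1)) _.
exact: germ_eqD (D2M _ _ hf1 hg) (D2M _ _ hf hg1).
Qed.

Lemma germ_leibniz3 D1 D2 D3 f g F :
  germ_derivation D1 -> germ_derivation D2 -> germ_derivation D3 ->
  hol f -> hol g -> germ_eq F (f * g) ->
  germ_eq (D3 (D2 (D1 F)))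
   ((D3 (D2 (D1 f)) * g + D2 (D1 f) * D3 g + (D3 (D1 f) * D2 g + D1 f * D3 (D2 g))) +
    (D3 (D2 f) * D1 g + D2 f * D3 (D1 g) + (D3 f * D2 (D1 g) + f * D3 (D2 (D1 g))))).
Proof.
move=> d1 d2 d3 hf hg hF.
have [D1h _ _ _] := d1; have [D2h _ _ _] := d2; have [D3h D3e D3D D3M] := d3.
have hf1 := D1h _ hf; have hg1 := D1h _ hg.
have hf2 := D2h _ hf; have hg2 := D2h _ hg.
have hf21 := D2h _ hf1; have hg21 := D2h _ hg1.
have h1 := holomorphicM hf21 hg; have h2 := holomorphicM hf1 hg2.
have h3 := holomorphicM hf2 hg1; have h4 := holomorphicM hf hg21.
apply: germ_eq_trans (D3e _ _ (germ_leibniz2 d1 d2 hf hg hF)) _.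
apply: germ_eq_trans (D3D _ _ (holomorphicD h1 h2) (holomorphicD h3 h4)) _.
apply: germ_eqD.
  apply: germ_eq_trans (D3D _ _ h1 h2) _.
  exact: germ_eqD (D3M _ _ hf21 hg) (D3M _ _ hf1 hg2).
apply: germ_eq_trans (D3D _ _ h3 h4) _.
exact: germ_eqD (D3M _ _ hf2 hg1) (D3M _ _ hf hg21).
Qed.

(** Bundling holomorphy of both sides lets congruences be composed along an expression without side
    conditions on [u] and [v]. *)
Definition germ_cong f u v :=
  [/\ hol u, hol v & exists2 w, hol w & germ_eq u (v + f * w)].

Lemma germ_congI f u v w : hol f -> hol v -> hol w -> germ_eq u (v + f * w) ->
  germ_cong f u v.
Proof.
move=> hf hv hw uv; split; last by exists w; [exact: hw|exact: uv].
  exact: holomorphic_germ_eq (germ_eq_sym uv) (holomorphicD hv (holomorphicM hf hw)).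
exact: hv.
Qed.

Lemma germ_cong_refl f u : hol u -> germ_cong f u u.
Proof.
move=> hu; split; [exact: hu|exact: hu|].
exists 0; first exact: (holomorphic_cst 0).
by apply: C2_nearW => q; rewrite mulr0 addr0.
Qed.

Lemma germ_congD f u u' v v' : germ_cong f u u' -> germ_cong f v v' ->
  germ_cong f (u + v) (u' + v').
Proof.
move=> [hu hu' [w hw uE]] [hv hv' [t ht vE]].
split; [exact: holomorphicD hu hv|exact: holomorphicD hu' hv'|].
exists (w + t); first exact: holomorphicD hw ht.
by apply: filterS2 uE vE => q; rewrite !fctE => -> ->; ring.
Qed.

Lemma germ_congN f u u' : germ_cong f u u' -> germ_cong f (- u) (- u').
Proof.
move=> [hu hu' [w hw uE]].
split; [exact: holomorphicN hu|exact: holomorphicN hu'|].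
exists (- w); first exact: holomorphicN hw.
by apply: filterS uE => q; rewrite !fctE => ->; ring.
Qed.

Lemma germ_cong_eq f u u' v v' : germ_cong f u v -> u = u' -> v = v' ->
  germ_cong f u' v'.
Proof. by move=> uv <- <-. Qed.

Lemma germ_congM f u u' v v' : hol f -> germ_cong f u u' -> germ_cong f v v' ->
  germ_cong f (u * v) (u' * v').
Proof.
move=> hf [hu hu' [w hw uE]] [hv hv' [t ht vE]].
split; [exact: holomorphicM hu hv|exact: holomorphicM hu' hv'|].
exists (u' * t + w * v' + f * w * t).
  apply: holomorphicD (holomorphicM (holomorphicM hf hw) ht).
  exact: holomorphicD (holomorphicM hu' ht) (holomorphicM hw hv').
by apply: filterS2 uE vE => q; rewrite !fctE => -> ->; ring.
Qed.

Lemma germ_congX f u u' n : hol f -> germ_cong f u u' -> germ_cong f (u ^+ n) (u' ^+ n).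
Proof.
move=> hf uu; elim: n => [|n IH]; first exact: germ_cong_refl (holomorphic_cst 1).
by rewrite !exprS; exact: germ_congM.
Qed.

Lemma intersection_number_cong f u v : hol f -> germ_cong f u v ->
  intersection_number f u = intersection_number f v.
Proof.
move=> hf [_ _ [w hw uE]]; apply: eq_intersection_number => t.
  apply: ideal_sub.
    have := ideal_l f v (holomorphic_cst 1).
    by apply: ideal_germ_eq; apply: C2_nearW => q; rewrite !fctE mul1r.
  have := ideal_comb f v hw (holomorphic_cst 1).
  by apply: ideal_germ_eq; apply: filterS uE => q; rewrite !fctE => ->; ring.
apply: ideal_sub.
  have := ideal_l f u (holomorphic_cst 1).
  by apply: ideal_germ_eq; apply: C2_nearW => q; rewrite !fctE mul1r.
have := ideal_comb f u (holomorphicN hw) (holomorphic_cst 1).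
by apply: ideal_germ_eq; apply: filterS uE => q; rewrite !fctE => ->; ring.
Qed.

Lemma germ_cong_leibniz D f g F : germ_derivation D -> hol f -> hol g ->
  germ_eq F (f * g) -> germ_cong f (D F) (D f * g).
Proof.
move=> d hf hg hF; have [Dh _ _ _] := d.
exact: (germ_congI hf (holomorphicM (Dh _ hf) hg) (Dh _ hg) (germ_leibniz d hf hg hF)).
Qed.

Lemma germ_cong_leibniz2 D1 D2 f g F : germ_derivation D1 -> germ_derivation D2 ->
  hol f -> hol g -> germ_eq F (f * g) ->
  germ_cong f (D2 (D1 F)) (D2 (D1 f) * g + D1 f * D2 g + D2 f * D1 g).
Proof.
move=> d1 d2 hf hg hF.
have [D1h _ _ _] := d1; have [D2h _ _ _] := d2.
have hf1 := D1h _ hf; have hg1 := D1h _ hg.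
have hf2 := D2h _ hf; have hg2 := D2h _ hg.
have hf21 := D2h _ hf1; have hg21 := D2h _ hg1.
apply: (germ_congI hf _ hg21).
  apply: holomorphicD (holomorphicM hf2 hg1).
  exact: holomorphicD (holomorphicM hf21 hg) (holomorphicM hf1 hg2).
(* Reassociation isolates the last Leibniz term, the only one that is a multiple of [f]. *)
rewrite -addrA; exact: germ_leibniz2.
Qed.

Lemma germ_cong_leibniz3 D1 D2 D3 f g F :
  germ_derivation D1 -> germ_derivation D2 -> germ_derivation D3 ->
  hol f -> hol g -> germ_eq F (f * g) ->
  germ_cong f (D3 (D2 (D1 F)))
   ((D3 (D2 (D1 f)) * g + D2 (D1 f) * D3 g + (D3 (D1 f) * D2 g + D1 f * D3 (D2 g))) +
    (D3 (D2 f) * D1 g + D2 f * D3 (D1 g) + D3 f * D2 (D1 g))).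
Proof.
move=> d1 d2 d3 hf hg hF.
have [D1h _ _ _] := d1; have [D2h _ _ _] := d2; have [D3h _ _ _] := d3.
have hf1 := D1h _ hf; have hg1 := D1h _ hg.
have hf2 := D2h _ hf; have hg2 := D2h _ hg.
have hf21 := D2h _ hf1; have hg21 := D2h _ hg1.
apply: (germ_congI hf _ (D3h _ hg21)).
  apply: holomorphicD.
    apply: holomorphicD; apply: holomorphicD.
    - exact: holomorphicM (D3h _ hf21) hg.
    - exact: holomorphicM hf21 (D3h _ hg).
    - exact: holomorphicM (D3h _ hf1) hg2.
    - exact: holomorphicM hf1 (D3h _ hg2).
  apply: holomorphicD; last exact: holomorphicM (D3h _ hf) hg21.
  by apply: holomorphicD; [exact: holomorphicM (D3h _ hf2) hg1|exact: holomorphicM hf2 (D3h _ hg1)].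
rewrite -addrA -[X in _ + X]addrA; exact: germ_leibniz3.
Qed.

Lemma inflection_germ_cong f g F : hol f -> hol g -> germ_eq F (f * g) ->
  germ_cong f (inflection_germ F) (g ^+ 3 * inflection_germ f).
Proof.
move=> hf hg hF.
have cx := germ_cong_leibniz dx_derivation hf hg hF.
have cy := germ_cong_leibniz dy_derivation hf hg hF.
have cxx := germ_cong_leibniz2 dx_derivation dx_derivation hf hg hF.
have cxy := germ_cong_leibniz2 dx_derivation dy_derivation hf hg hF.
have cyy := germ_cong_leibniz2 dy_derivation dy_derivation hf hg hF.
have c2 := germ_cong_refl f (holomorphic_nat R 2).
have cM u u' v v' := @germ_congM f u u' v v' hf.
have cX u u' n := @germ_congX f u u' n hf.
(* The congruence is assembled following the syntax of [inflection_germ], so that only an identity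
   in a commutative ring is left. *)
have := germ_congD (germ_congD (cM _ _ _ _ (cX _ _ 2 cy) cxx)
  (germ_congN (cM _ _ _ _ (cM _ _ _ _ (cM _ _ _ _ c2 cx) cy) cxy)))
  (cM _ _ _ _ (cX _ _ 2 cx) cyy).
move/germ_cong_eq; apply; first by rewrite /inflection_germ.
exact: inflection_leibniz_identity.
Qed.

Lemma vertex_germ_cong f g F : hol f -> hol g -> germ_eq F (f * g) ->
  germ_cong f (vertex_germ F) (g ^+ 6 * vertex_germ f).
Proof.
move=> hf hg hF.
have Dx := dx_derivation; have Dy := dy_derivation.
have cx := germ_cong_leibniz Dx hf hg hF.
have cy := germ_cong_leibniz Dy hf hg hF.
have cxx := germ_cong_leibniz2 Dx Dx hf hg hF.
have cxy := germ_cong_leibniz2 Dx Dy hf hg hF.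
have cyy := germ_cong_leibniz2 Dy Dy hf hg hF.
have cxxx := germ_cong_leibniz3 Dx Dx Dx hf hg hF.
have cxxy := germ_cong_leibniz3 Dx Dx Dy hf hg hF.
have cxyy := germ_cong_leibniz3 Dx Dy Dy hf hg hF.
have cyyy := germ_cong_leibniz3 Dy Dy Dy hf hg hF.
have c3 := germ_cong_refl f (holomorphic_nat R 3).
(* The inflection factor enters already reduced to [g ^+ 3 * inflection_germ f], as in
   [vertex_leibniz_identity]. *)
have ci := inflection_germ_cong hf hg hF.
have cM u u' v v' := @germ_congM f u u' v v' hf.
have cX u u' n := @germ_congX f u u' n hf.
have cD := @germ_congD f; have cN := @germ_congN f.
have t1 := cM _ _ _ _ (cX _ _ 3 cx) cyyy.
have t2 := cM _ _ _ _ (cM _ _ _ _ (cM _ _ _ _ c3 (cX _ _ 2 cx)) cy) cxyy.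
have t3 := cM _ _ _ _ (cM _ _ _ _ (cM _ _ _ _ c3 cx) (cX _ _ 2 cy)) cxxy.
have t4 := cM _ _ _ _ (cX _ _ 3 cy) cxxx.
have s1 := cD _ _ _ _ (cX _ _ 2 cx) (cX _ _ 2 cy).
have s2 := cM _ _ _ _ (cD _ _ _ _ (cX _ _ 2 cx) (cN _ _ (cX _ _ 2 cy))) cxy.
have s3 := cM _ _ _ _ (cM _ _ _ _ cx cy) (cD _ _ _ _ cxx (cN _ _ cyy)).
have a1 := cM _ _ _ _ s1 (cD _ _ _ _ (cD _ _ _ _ (cD _ _ _ _ t1 (cN _ _ t2)) t3) (cN _ _ t4)).
have a2 := cM _ _ _ _ (cM _ _ _ _ c3 (cD _ _ _ _ s2 (cN _ _ s3))) ci.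
have := cD _ _ _ _ a1 (cN _ _ a2).
move/germ_cong_eq; apply; first by rewrite /vertex_germ.
exact: vertex_leibniz_identity.
Qed.

(** Only the weight [k] of the congruence matters: each [fs i] meets the [k]-th power of the product
    of the others, so each unordered pair is counted [2 * k] times. *)
Lemma intersection_number_sum_leibniz (E : (C2 R -> R[i]) -> C2 R -> R[i]) (k n : nat)
    f (fs : 'I_n -> C2 R -> R[i]) :
  (forall u v F, hol u -> hol v -> germ_eq F (u * v) ->
    germ_cong u (E F) (v ^+ k * E u)) ->
  hol f -> (forall i, hol (fs i)) -> germ_eq f (\prod_(i < n) fs i) ->
  (intersection_number f (E f) =
   \sum_(i < n) intersection_number (fs i) (E (fs i)) +
   (2 * k)%:R%:E * \sum_(i < n) \sum_(j < n | (i < j)%N)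
     intersection_number (fs i) (fs j))%E.
Proof.
move=> Econg hf hfs fE.
(* Holomorphy is read off the congruence for the trivial factorization [u = u * 1]. *)
have hE u : hol u -> hol (E u).
  move=> hu; have u1 : germ_eq u (u * 1) by rewrite mulr1; exact: germ_eq_refl.
  by have [hEu _ _] := Econg _ _ _ hu (holomorphic_cst 1) u1; exact: hEu.
(* Only the first argument is replaced by the product; by symmetry it then moves to the second,
   where additivity applies. *)
rewrite (intersection_number_germ_eq fE (germ_eq_refl _)) intersection_numberC.
rewrite (intersection_number_prod _ _ (hE _ hf) hfs).
pose M i j := intersection_number (fs i) (fs j).
have M0 i j : (0 <= M i j)%E by exact: intersection_number_ge0.
have factor i : intersection_number (E f) (fs i) =
    (intersection_number (fs i) (E (fs i)) + k%:R%:E * \sum_(j < n | j != i) M i j)%E.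
  have hg : hol (\prod_(j < n | j != i) fs j) by exact: holomorphic_prod.
  have fi : germ_eq f (fs i * \prod_(j < n | j != i) fs j).
    by move: fE; rewrite (bigD1 i).
  rewrite intersection_numberC.
  rewrite (intersection_number_cong (hfs i) (Econg _ _ _ (hfs i) hg fi)).
  rewrite (intersection_numberM (hfs i) (holomorphicX k hg) (hE _ (hfs i))).
  rewrite (intersection_numberX k (hfs i) hg) addeC.
  by rewrite (intersection_number_prod _ _ (hfs i) hfs).
under eq_bigr => i _ do rewrite factor.
rewrite big_split/=; congr (_ + _)%E.
(* Values may be [+oo], so distributivity relies on nonnegativity. *)
rewrite -ge0_sume_distrr; last by move=> i _; exact: sume_ge0.
set T := (\sum_(i < n) \sum_(j < n | (i < j)%N) M i j)%E.
have -> : (\sum_(i < n) \sum_(j < n | j != i) M i j = T + T)%E.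
  have -> : (\sum_(i < n) \sum_(j < n | j != i) M i j =
      T + \sum_(i < n) \sum_(j < n | (j < i)%N) M i j)%E.
    rewrite -big_split; apply: eq_bigr => i _.
    rewrite (bigID (fun j : 'I_n => (i < j)%N))/=; congr (_ + _)%E.
      by apply: eq_bigl => j; rewrite -val_eqE/=; case: ltngtP.
    by apply: eq_bigl => j; rewrite -val_eqE/=; case: ltngtP.
  (* Exchanging the sums and using symmetry turns the pairs [j < i] into a second copy of [T]. *)
  congr (_ + _)%E; rewrite (exchange_big_dep xpredT)//=; apply: eq_bigr => j _.
  by apply: eq_bigr => i _; exact: intersection_numberC.
have T0 : (0 <= T)%E by apply: sume_ge0 => i _; exact: sume_ge0.
rewrite mulnC natrM EFinM -muleA; congr (_ * _)%E.
by rewrite -[2%:R]/(1 + 1) EFinD ge0_muleDl ?lee_fin// mul1e.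
Qed.

End Congruences.

Unset Implicit Arguments.

Theorem theorem3p4 (R : realType) (n : nat)
  (f : C2 R -> R[i]) (fs : 'I_n -> (C2 R -> R[i]))
  (f_hol : holomorphic_germ f) (f0 : f 0 = 0)
  (fs_hol : forall i, holomorphic_germ (fs i)) (fs0 : forall i, fs i 0 = 0)
  (f_prod : germ_eq f (\prod_(i < n) fs i))
  (f_red : germ_reduced f) :
  (inflection_number f =
     \sum_(i < n) inflection_number (fs i)
     + 6%:R%:E * \sum_(i < n) \sum_(j < n | (i < j)%N)
         intersection_number (fs i) (fs j))%E /\
  (vertex_number f =
     \sum_(i < n) vertex_number (fs i)
     + 12%:R%:E * \sum_(i < n) \sum_(j < n | (i < j)%N)
         intersection_number (fs i) (fs j))%E.
Proof.
split.
- exact: (intersection_number_sum_leibniz (k := 3)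
    (@inflection_germ_cong R) f_hol fs_hol f_prod).
- exact: (intersection_number_sum_leibniz (k := 6)
    (@vertex_germ_cong R) f_hol fs_hol f_prod).
Qed.
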